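(* Let $\Omega\subset\mathbb{R}^2$ have properties (i), $( * )$ and $( ** )$, and let $\cosh_\Omega,\sinh_\Omega$ and $\cosh_{\Omega^\diamond},\sinh_{\Omega^\diamond}$ be defined as in the context. Then $\cosh_\Omega$ and $\sinh_\Omega$ are locally Lipschitz and therefore differentiable almost everywhere. If for an angle $\theta$ the set $\theta^\diamond$ consists of a single element $\eta$, then $$\frac{d}{d\theta}\cosh_\Omega\theta=\sinh_{\Omega^\diamond}\eta,\qquad \frac{d}{d\theta}\sinh_\Omega\theta=\cosh_{\Omega^\diamond}\eta.$$ There is at most a countable set of values of $\theta$ where the left and right derivatives of $\cosh_\Omega$ (respectively $\sinh_\Omega$) differ; at such $\theta$ the set $\{\sinh_{\Omega^\diamond}\eta:\eta\in\theta^\diamond\}$ (respectively $\{\cosh_{\Omega^\diamond}\eta:\eta\in\theta^\diamond\}$) lies between the left and right derivatives of $\cosh_\Omega$ (respectively $\sinh_\Omega$).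
   Context: Points of $\mathbb{R}^2$ are $(x,y)$, points of $\mathbb{R}^{2*}$ are $(p,q)$. Antipolar: $\Omega^\diamond=\{(p,q): px-qy\ge1\ \forall(x,y)\in\Omega\}$. Property (i): $\Omega$ nonempty, convex, closed, $0\notin\Omega$, $\lambda\Omega\subset\Omega$ for all $\lambda>1$. Property $( * )$: $\lambda\Omega\cap\partial\Omega=\varnothing$ for all $\lambda>1$. Property $( ** )$: with $C=\operatorname{cl}(\mathbb{R}_+\Omega)$ and $\partial C=l_0\cup l_1$ its two boundary rays, $\operatorname{dist}(l_0,\Omega)=\operatorname{dist}(l_1,\Omega)=0$. (Under these assumptions $\Omega^\diamond$ also has properties (i), $( * )$, $( ** )$.) Hyperbolic convex trigonometric functions: fix $\omega_0=(x_0,y_0)\in\partial\Omega$ and $\omega_0^\diamond=(p_0,q_0)\in\partial\Omega^\diamond$ with $p_0x_0-q_0y_0=1$. For $\omega=(x,y)\in\partial\Omega$ let $\theta$ be twice the signed area of the region bounded by the segment from the origin $O$ to $\omega_0$, the arc of $\partial\Omega$ from $\omega_0$ to $\omega$, and the segment from $\omega$ to $O$ (positive when the arc runs counterclockwise); set $\cosh_\Omega\theta=x$, $\sinh_\Omega\theta=y$. The domain of these functions is the (open) interval or line of values of $\theta$ obtained this way. The functions $\cosh_{\Omega^\diamond}\eta,\sinh_{\Omega^\diamond}\eta$ are defined in the same way from $\Omega^\diamond$ and $\omega_0^\diamond$ in the $(p,q)$-plane. For $\theta$ in the domain of $\cosh_\Omega$, $\theta^\diamond$ is the set of $\eta$ with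 $\cosh_\Omega\theta\cosh_{\Omega^\diamond}\eta-\sinh_\Omega\theta\sinh_{\Omega^\diamond}\eta=1$ (the left-hand side is always $\ge1$). *)

(* Defs.v *)
From HB Require Import structures.
From mathcomp Require Import all_boot all_order all_algebra.
From mathcomp Require Import all_classical all_reals all_analysis.
Set Implicit Arguments. Unset Strict Implicit. Unset Printing Implicit Defensive.
Import Order.TTheory GRing.Theory Num.Theory.
Import numFieldNormedType.Exports.
Local Open Scope classical_set_scope.
Local Open Scope ring_scope.

Section Plane.
Variable R : realType.
Implicit Types (O : set (R * R)) (a b p : R * R).

Definition scal (l : R) p : R * R := (l * p.1, l * p.2).
(* determinant a.x * b.y - a.y * b.x; > 0 iff b is counterclockwise from a *)
Definition det2 a b : R := a.1 * b.2 - a.2 * b.1.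

Definition bdry O : set (R * R) := closure O `\` interior O.

Definition antipolar O : set (R * R) :=
  [set w | forall v, O v -> 1 <= w.1 * v.1 - w.2 * v.2].

Definition convex_set2 O : Prop :=
  forall a b (t : R), O a -> O b -> 0 <= t <= 1 ->
    O (t * a.1 + (1 - t) * b.1, t * a.2 + (1 - t) * b.2).

Definition prop_i O : Prop :=
  O !=set0 /\ convex_set2 O /\ closed O /\ ~ O (0, 0) /\
  (forall l : R, 1 < l -> scal l @` O `<=` O).

Definition prop_star O : Prop :=
  forall l : R, 1 < l -> scal l @` O `&` bdry O = set0.

Definition ray u : set (R * R) := [set p | exists t : R, 0 <= t /\ p = scal t u].

Definition cone_hull O : set (R * R) :=
  closure [set p | exists t w, 0 <= t /\ O w /\ p = scal t w].

Definition dist_zero (L O : set (R * R)) : Prop :=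
  forall e : R, 0 < e -> exists p w, L p /\ O w /\
    `|p.1 - w.1| < e /\ `|p.2 - w.2| < e.

Definition prop_2star O : Prop :=
  exists u0 u1 : R * R, u0 != (0, 0) /\ u1 != (0, 0) /\
    bdry (cone_hull O) = ray u0 `|` ray u1 /\
    dist_zero (ray u0) O /\ dist_zero (ray u1) O.

Definition cone2 a b : set (R * R) :=
  [set p | exists s t : R, 0 <= s /\ 0 <= t /\
     p = (s * a.1 + t * b.1, s * a.2 + t * b.2)].

(* region bounded by the segment O w0, the arc of bdry O from w0 to w, and
   the segment w O : union of the segments from the origin to the arc *)
Definition sector O w0 w : set (R * R) :=
  [set q | exists (t : R) p, 0 <= t <= 1 /\ bdry O p /\ cone2 w0 w p /\ q = scal t p].

Definition area (A : set (R * R)) : R :=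
  fine ((@lebesgue_measure R \x @lebesgue_measure R)%E A).

(* twice the signed area, positive when the arc runs counterclockwise *)
Definition angle O w0 w : R :=
  Num.sg (det2 w0 w) * (2 * area (sector O w0 w)).

Definition angle_dom O w0 : set R := [set angle O w0 w | w in bdry O].

Definition is_hyp_trig O w0 (ch sh : R -> R) : Prop :=
  forall theta, angle_dom O w0 theta ->
    bdry O (ch theta, sh theta) /\ angle O w0 (ch theta, sh theta) = theta.

Definition dual_angles Od w0d (ch sh chd shd : R -> R) (theta : R) : set R :=
  [set eta | angle_dom Od w0d eta /\
             ch theta * chd eta - sh theta * shd eta = 1].

Definition locally_lipschitz_on (D : set R) (f : R -> R) : Prop :=
  forall x, D x -> exists e k : R, 0 < e /\ forall a b : R, D a -> D b ->
    `|a - x| < e -> `|b - x| < e -> `|f a - f b| <= k * `|a - b|.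

Definition left_deriv (f : R -> R) x (l : R) : Prop :=
  (fun h => h^-1 * (f (x + h) - f x)) @ 0^'- --> l.
Definition right_deriv (f : R -> R) x (l : R) : Prop :=
  (fun h => h^-1 * (f (x + h) - f x)) @ 0^'+ --> l.

Definition between (l r v : R) : Prop := Num.min l r <= v <= Num.max l r.

End Plane.

(* Main.v *)
(* Write w for a boundary point of Om and theta for its angle.  Convexity together with
   property ( * ) makes [det2] superadditive along the boundary, and it traps the sector
   between two boundary points between triangles; hence the increment of theta lies between
   [det2 (w s) (w t)] times a factor tending to 1, and [det2 (w s) (w t)] itself.  So theta is
   a locally bi-Lipschitz parameter of the boundary, and the slopes of the chords issuing
   from a boundary point [a], measured in a basis [(a, d)] with [det2 a d = 1], are monotone in
   the other endpoint.  Their one-sided limits give the one-sided derivatives of w.  The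
   directions between these limits are exactly those with [det2 a d = 1] and [1 <= det2 v d]
   on Om, that is, up to exchanging coordinates, the points of the antipolar boundary dual
   to [a].  At a corner a rational direction in between gives a functional that is minimal
   at that corner only, so there are countably many corners.  Property ( ** ) enters only to
   show that the antipolar also has ( * ), which makes its angle injective. *)
Require Import Defs.
From HB Require Import structures.
From mathcomp Require Import all_boot all_order all_algebra.
From mathcomp Require Import all_classical all_reals all_analysis.
From mathcomp Require Import measurable_realfun ring lra.
Set Implicit Arguments. Unset Strict Implicit. Unset Printing Implicit Defensive.
Import Order.TTheory GRing.Theory Num.Theory.
Import numFieldNormedType.Exports.
Local Open Scope classical_set_scope.
Local Open Scope ring_scope.

(** * Area of a triangle with a vertex at the origin *)

Section PlaneMeasure.
Context {R : realType}.
Local Notation mu := (@lebesgue_measure R).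
Local Notation mu2 := (mu \x mu)%E.
Implicit Types (A : set (R * R)) (a b p : R * R).

(** As a function of [B] the left side is a measure that gives half-open intervals their length,
    which characterises Lebesgue measure. *)
Lemma lebesgue_measure_affine (c d : R) (B : set R) : d != 0 -> measurable B ->
  (`|d|%:E * mu ((fun y => (c + d * y)%R) @^-1` B) = mu B)%E.
Proof.
move=> d0 mB.
pose f : measurableTypeR R -> measurableTypeR R := fun y => c + d * y.
have mf : measurable_fun setT f by exact: measurable_funD.
pose nu :=
   mscale (NngNum (normr_ge0 d)) (pushforward mu f) : {measure set (measurableTypeR R) -> \bar R}.
rewrite -[LHS]/(nu mf B); apply/esym/lebesgue_measure_unique => // _ [[u v]] _ <-.
rewrite /= /mscale /= /pushforward /= lebesgue_measure_itv/= lte_fin.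
have [dpos|dneg|/eqP] := ltgtP 0 d; last by rewrite eq_sym (negbTE d0).
- rewrite (_ : f @^-1` _ = `](u - c) / d, (v - c) / d]%classic); last first.
    apply/seteqP; split=> y /=; rewrite !in_itv/= ltr_pdivrMr// ler_pdivlMr// /f; lra.
  rewrite lebesgue_measure_itv/= lte_fin ltr_pM2r ?invr_gt0// ltrD2r.
  case: ifP => _; last by rewrite mule0.
  by rewrite -!EFinB -EFinM gtr0_norm//; congr EFin; field.
(* A negative factor reverses the interval, so its closed end changes sides. *)
- rewrite (_ : f @^-1` _ = `[(v - c) / d, (u - c) / d[%classic); last first.
    apply/seteqP; split=> y /=; rewrite !in_itv/= ltr_ndivlMr// ler_ndivrMr// /f; lra.
  rewrite lebesgue_measure_itv/= lte_fin ltr_nM2r ?invr_lt0// ltrD2r.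
  case: ifP => _; last by rewrite mule0.
  by rewrite -!EFinB -EFinM ltr0_norm//; congr EFin; field.
Qed.

Lemma measurable_fun_linear (c d : R) :
  measurable_fun [set: R * R] (fun p : R * R => c * p.1 + d * p.2).
Proof.
by apply: measurable_funD; apply: measurable_funM.
Qed.

Lemma measurable_halfplane (c d e : R) :
  measurable [set p : R * R | e <= c * p.1 + d * p.2].
Proof.
have := @measurable_fun_linear c d measurableT (`[e, +oo[%classic : set R) (measurable_itv _).
by rewrite setTI; congr measurable; apply/seteqP; split=> p /=; rewrite in_itv/= andbT.
Qed.

Lemma plane_measure2 A : measurable A -> mu2 A = (mu \x^ mu)%E A.
Proof.
move=> mA; pose nu := (mu \x^ mu)%E : {measure set (measurableTypeR R * measurableTypeR R) -> \bar R}.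
by apply: (@product_measure_unique _ _ _ _ R mu mu nu) => // B C mB mC; exact: product_measure2E.
Qed.

(** On each vertical section the shear is an affine map of the line, so the one-dimensional rule
    applies under the integral. *)
Lemma plane_measure_shear_snd (c d : R) A : d != 0 -> measurable A ->
  (`|d|%:E * mu2 ((fun p => (p.1, c * p.1 + d * p.2)%R) @^-1` A) = mu2 A)%E.
Proof.
move=> d0 mA; pose F (p : R * R) := (p.1, c * p.1 + d * p.2).
have mF : measurable_fun setT F.
  by apply: measurable_fun_pair; [exact: measurable_fst|exact: measurable_fun_linear].
have mFA : measurable (F @^-1` A) by rewrite -[X in measurable X]setTI; exact: mF.
rewrite /product_measure1 -ge0_integralZl//=; last first.
  exact: measurable_fun_xsection.
apply: eq_integral => x _ /=.
rewrite -(@lebesgue_measure_affine (c * x) d (xsection A x) d0); last exact: measurable_xsection.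
by congr (_ * lebesgue_measure _)%E; apply/seteqP; split=> y /=; rewrite /xsection /= !inE.
Qed.

Lemma plane_measure_shear_fst (c d : R) A : c != 0 -> measurable A ->
  (`|c|%:E * mu2 ((fun p => (c * p.1 + d * p.2, p.2)%R) @^-1` A) = mu2 A)%E.
Proof.
move=> c0 mA; pose F (p : R * R) := (c * p.1 + d * p.2, p.2).
have mF : measurable_fun setT F.
  by apply: measurable_fun_pair; [exact: measurable_fun_linear|exact: measurable_snd].
have mFA : measurable (F @^-1` A) by rewrite -[X in measurable X]setTI; exact: mF.
rewrite !plane_measure2// /product_measure2 -ge0_integralZl//=; last first.
  exact: measurable_fun_ysection.
apply: eq_integral => y _ /=.
rewrite -(@lebesgue_measure_affine (d * y) c (ysection A y) c0); last exact: measurable_ysection.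
by congr (_ * lebesgue_measure _)%E; apply/seteqP; split=> x /=; rewrite /ysection /= !inE addrC.
Qed.

Definition triangle a b : set (R * R) :=
  [set p | exists s t : R, [/\ 0 <= s, 0 <= t, s + t <= 1 &
     p = (s * a.1 + t * b.1, s * a.2 + t * b.2)]].

Lemma triangleC a b : triangle a b = triangle b a.
Proof.
by apply/seteqP; split=> p [s] [t] [? ? ? ->]; exists t, s; split=> //;
  rewrite addrC//; congr pair; rewrite addrC.
Qed.

(** Cramer's rule: the coefficients of [p] in the basis [a], [b] are [det2 p b] and [det2 a p], both
    divided by [det2 a b]. *)
Lemma triangleP a b p : 0 < det2 a b -> triangle a b p <->
  [/\ 0 <= det2 p b, 0 <= det2 a p & det2 p b + det2 a p <= det2 a b].
Proof.
move=> ab; split.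
  move=> [s] [t] [s0 t0 st ->].
  have -> : det2 (s * a.1 + t * b.1, s * a.2 + t * b.2) b = s * det2 a b.
    by rewrite /det2/=; ring.
  have -> : det2 a (s * a.1 + t * b.1, s * a.2 + t * b.2) = t * det2 a b.
    by rewrite /det2/=; ring.
  by rewrite -mulrDl ger_pMl//; split=> //; rewrite mulr_ge0// ltW.
move=> [h1 h2 h3]; exists (det2 p b / det2 a b), (det2 a p / det2 a b); split.
- by rewrite divr_ge0// ltW.
- by rewrite divr_ge0// ltW.
- by rewrite -mulrDl ler_pdivrMr// mul1r.
have ab0 : a.1 * b.2 - a.2 * b.1 != 0 by rewrite -/(det2 a b) gt_eqF.
by rewrite (surjective_pairing p) /det2 /=; congr pair; field.
Qed.

Lemma measurable_triangle a b : 0 < det2 a b -> measurable (triangle a b).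
Proof.
move=> ab.
rewrite (_ : triangle a b = [set p | 0 <= b.2 * p.1 + (- b.1) * p.2] `&`
   [set p | 0 <= (- a.2) * p.1 + a.1 * p.2] `&`
   [set p | - det2 a b <= (a.2 - b.2) * p.1 + (b.1 - a.1) * p.2]); last first.
  apply/seteqP; split=> p.
    by move=> /(triangleP _ ab); rewrite /det2 => -[? ? ?]; split; [split|] => /=; nra.
  by rewrite /= /det2 => -[[h1 h2] h3]; apply/(triangleP _ ab); rewrite /det2; split; nra.
by do 2?apply: measurableI; exact: measurable_halfplane.
Qed.

Lemma unit_triangle_measure : mu2 (triangle (1, 0) (0, 1)) = (2^-1)%:E.
Proof.
have d1 : det2 (1, 0) (0, 1) = 1 :> R by rewrite /det2/=; ring.
have T0 : 0 < det2 (1, 0) (0, 1) :> R by rewrite d1.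
rewrite /product_measure1 /=.
transitivity (\int[mu]_(x in `[0%R, 1%R]) (1 - x)%:E)%E.
  rewrite [RHS]integral_mkcond; apply: eq_integral => x _; rewrite patchE /=.
  have sec y : xsection (triangle (1, 0) (0, 1)) x y <-> [/\ 0 <= x, 0 <= y & x + y <= 1].
    rewrite /xsection/= inE; split; first by move/(triangleP _ T0); rewrite d1 /det2 /= => -[? ? ?]; split; lra.
    by move=> [? ? ?]; apply/(triangleP _ T0); rewrite d1 /det2 /=; split; lra.
  case: ifPn => [/set_mem|/negP x01].
    rewrite /= in_itv/= => /andP[x0 x1].
    rewrite (_ : xsection _ _ = `[0, 1 - x]%classic); last first.
      apply/seteqP; split=> y; first by move=> /sec[? ? ?] /=; rewrite in_itv/=; lra.
      by rewrite /= in_itv/= => /andP[? ?]; apply/sec; split; lra.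
    rewrite lebesgue_measure_itv/= lte_fin; case: ltP; first by rewrite -EFinB subr0.
    by move=> ?; congr EFin; lra.
  rewrite (_ : xsection _ _ = set0) ?measure0//.
  apply/seteqP; split=> y // /sec[? ? ?]; apply: x01; apply/mem_set.
  by rewrite /= in_itv/=; lra.
have ab : (0 : R) < 1 by [].
pose F (x : R) := x - x ^+ 2 / 2.
have dF x : is_derive (x : R) 1 F (1 - x).
  rewrite /F; apply: is_derive_eq; rewrite /GRing.scale/=; lra.
rewrite (@continuous_FTC2 _ (fun x => 1 - x) F)//.
- by rewrite /F -EFinB; congr EFin; lra.
- apply: continuous_subspaceT => x; apply: cvgB; [exact: cvg_cst|exact: cvg_id].
- split=> //.
  + by apply: cvg_at_right_filter; apply: differentiable_continuous; apply/derivable1_diffP.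
  + by apply: cvg_at_left_filter; apply: differentiable_continuous; apply/derivable1_diffP.
- by move=> x _; rewrite derive1E; exact: derive_val.
Qed.

(** The linear map with columns [u] and [v] is a product of two shears, each scaling areas by its
    diagonal entry, which reduces everything to the unit triangle. *)
Lemma triangle_measure a b : 0 < det2 a b -> mu2 (triangle a b) = (det2 a b / 2)%:E.
Proof.
(* The absolute value lets the same statement serve the exchanged pair, used when [a.1] vanishes and
   the factorisation breaks down. *)
have main u v : 0 < `|det2 u v| -> measurable (triangle u v) -> u.1 != 0 ->
    mu2 (triangle u v) = (`|det2 u v| / 2)%:E.
  move=> uv mT u0.
  have k0 : det2 u v / u.1 != 0 by rewrite mulf_neq0// ?invr_eq0// -normr_gt0.
  rewrite -(plane_measure_shear_snd (u.2 / u.1) k0 mT).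
  set F := (fun p : R * R => _).
  have mF : measurable_fun setT F.
    by apply: measurable_fun_pair; [exact: measurable_fst|exact: measurable_fun_linear].
  have mFA : measurable (F @^-1` triangle u v) by rewrite -[X in measurable X]setTI; exact: mF.
  rewrite -(plane_measure_shear_fst v.1 u0 mFA).
  set G := (fun p : R * R => _).
  (* [F] after [G] sends [(s, t)] to the combination of [u] and [v] with these coefficients. *)
  rewrite (_ : G @^-1` _ = triangle (1, 0) (0, 1)); last first.
    have FG p : F (G p) = (p.1 * u.1 + p.2 * v.1, p.1 * u.2 + p.2 * v.2).
      by rewrite /F /G /= /det2; congr pair; field.
    apply/seteqP; split=> p; rewrite /= ?FG.
      move=> [s] [t] [s0 t0 st [e1 e2]]; exists s, t; split=> //.
      rewrite (surjective_pairing p) !mulr0 !mulr1 add0r addr0.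
      have E1 : (p.1 - s) * det2 u v = 0.
        rewrite /det2; transitivity ((p.1 * u.1 + p.2 * v.1 - (s * u.1 + t * v.1)) * v.2 -
          (p.1 * u.2 + p.2 * v.2 - (s * u.2 + t * v.2)) * v.1); first by ring.
        by rewrite e1 e2; ring.
      have E2 : (p.2 - t) * det2 u v = 0.
        rewrite /det2; transitivity ((p.1 * u.2 + p.2 * v.2 - (s * u.2 + t * v.2)) * u.1 -
          (p.1 * u.1 + p.2 * v.1 - (s * u.1 + t * v.1)) * u.2); first by ring.
        by rewrite e1 e2; ring.
      have d0 : det2 u v != 0 by rewrite -normr_gt0.
      move/eqP: E1; rewrite mulf_eq0 (negbTE d0) orbF subr_eq0 => /eqP ->.
      by move/eqP: E2; rewrite mulf_eq0 (negbTE d0) orbF subr_eq0 => /eqP ->.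
    move=> [s] [t] [s0 t0 st ->]; rewrite /= !mulr0 !mulr1 add0r addr0.
    by exists s, t.
  rewrite unit_triangle_measure -!EFinM normrM normrV ?unitfE//; congr EFin.
  by field; rewrite normr_eq0.
move=> ab; have mT := measurable_triangle ab.
have [a0|a0] := eqVneq a.1 0.
  have b0 : b.1 != 0 by apply/eqP => b0; move: ab; rewrite /det2 a0 b0 mulr0 mul0r subrr ltxx.
  have ba : det2 b a = - det2 a b by rewrite /det2; ring.
  by rewrite triangleC main ?ba ?normrN ?gtr0_norm// triangleC.
by rewrite main ?gtr0_norm.
Qed.
End PlaneMeasure.

(** * Measurability of open sets, and lines through the origin as null sets *)

Section PlaneBorel.
Context {R : realType}.
Local Notation mu := (@lebesgue_measure R).
Local Notation mu2 := (mu \x mu)%E.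

Lemma measurable_det2_line (b : R * R) : measurable [set p | det2 b p = 0].
Proof.
rewrite (_ : mkset _ = [set p | 0 <= (- b.2) * p.1 + b.1 * p.2] `&`
  [set p | 0 <= b.2 * p.1 + (- b.1) * p.2]).
  by apply: measurableI; exact: measurable_halfplane.
by apply/seteqP; split=> p /=; rewrite /det2; [move=> ?; split; lra|move=> [? ?]; lra].
Qed.

Lemma det2_line_null (b : R * R) : b != (0, 0) -> mu2 [set p | det2 b p = 0] = 0%E.
Proof.
move=> b0.
have mL := measurable_det2_line b.
have [b1|b1] := eqVneq b.1 0.
  have b2 : b.2 != 0.
    by apply: contraNneq b0 => b2; rewrite (surjective_pairing b) b1 b2.
  rewrite plane_measure2// /product_measure2 integral0_eq// => y _ /=.
  rewrite (_ : ysection _ _ = [set 0]) ?lebesgue_measure_set1//.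
  apply/seteqP; split=> x; rewrite /ysection/= ?inE /= /det2 /= b1.
    by rewrite mul0r sub0r => /eqP; rewrite oppr_eq0 mulf_eq0 (negbTE b2)/= => /eqP.
  by move=> ->; ring.
rewrite /product_measure1 integral0_eq// => x _ /=.
rewrite (_ : xsection _ _ = [set (b.2 * x / b.1)]) ?lebesgue_measure_set1//.
apply/seteqP; split=> y; rewrite /xsection/= ?inE /= /det2 /=.
  by move=> /eqP; rewrite subr_eq0 => /eqP <-; field.
by move=> ->; field.
Qed.

(** The squares with rational centre and half-width contained in [U] are countably many and cover
    it. *)
Lemma open_plane_measurable (U : set (R * R)) : open U -> measurable U.
Proof.
move=> oU.
pose box (q : rat * rat * rat) : set (R * R) :=
  `]ratr q.1.1 - ratr q.2, ratr q.1.1 + ratr q.2[%classic `*`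
  `]ratr q.1.2 - ratr q.2, ratr q.1.2 + ratr q.2[%classic.
pose F q := if `[< box q `<=` U >] then box q else set0.
rewrite (_ : U = \bigcup_q F q).
  apply: countable_bigcupT_measurable => [|q]; first exact: countableP.
  by rewrite /F; case: ifP => // _; apply: measurableX; exact: measurable_itv.
apply/seteqP; split=> p; last first.
  by move=> [q _]; rewrite /F; case: ifPn => // /asboolP; exact.
move=> Up; have := open_nbhs_nbhs (conj oU Up); rewrite -nbhs_ballE => -[e /= e0 pe].
have [r] := @rat_in_itvoo R 0 (e / 2) ltac:(lra).
rewrite in_itv/= => /andP[r0 re].
have [q1] := @rat_in_itvoo R (p.1 - ratr r) (p.1 + ratr r) ltac:(lra).
have [q2] := @rat_in_itvoo R (p.2 - ratr r) (p.2 + ratr r) ltac:(lra).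
rewrite !in_itv/= => /andP[h1 h2] /andP[h3 h4].
exists (q1, q2, r) => //; rewrite /F ifT.
  by split; rewrite /= in_itv/=; lra.
apply/asboolP => x [/=]; rewrite !in_itv/= => /andP[? ?] /andP[? ?].
by apply: pe; split; rewrite /ball/= ltr_norml; lra.
Qed.
End PlaneBorel.

(** * Rays from the origin, and determinants of points of the convex set *)

Section ConvexGeometry.
Context {R : realType}.
Variable Om : set (R * R).
Hypotheses (Hi : prop_i Om) (Hs : prop_star Om).
Implicit Types (a b c e p q v : R * R).

Lemma scalA (l m : R) p : scal l (scal m p) = scal (l * m) p.
Proof. by rewrite /scal/= !mulrA. Qed.

Lemma det2C a b : det2 b a = - det2 a b.
Proof. by rewrite /det2; ring. Qed.

Lemma det2Zl (l : R) a b : det2 (scal l a) b = l * det2 a b.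
Proof. by rewrite /det2/=; ring. Qed.

Lemma det2Zr (l : R) a b : det2 a (scal l b) = l * det2 a b.
Proof. by rewrite /det2/=; ring. Qed.

(** The linear relation among three plane vectors; with nonnegative coefficients it locates where
    the ray of [b] meets the chord from [a] to [c]. *)
Lemma det2_jacobi a b c :
  scal (det2 a c) b = (det2 b c * a.1 + det2 a b * c.1, det2 b c * a.2 + det2 a b * c.2).
Proof. by rewrite /det2 /scal; congr pair; ring. Qed.

Lemma sum_sqr_gt0 a : a != (0, 0) -> 0 < a.1 ^+ 2 + a.2 ^+ 2.
Proof.
move=> a0; rewrite lt_neqAle addr_ge0 ?sqr_ge0// andbT eq_sym.
by rewrite paddr_eq0 ?sqr_ge0// !sqrf_eq0; move: a0; rewrite {1}(surjective_pairing a) xpair_eqE.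
Qed.

Lemma bdry_mem p : bdry Om p -> Om p.
Proof. by case: Hi => _ [_ [cO _]] [+ _] => /cO. Qed.

Lemma mem_bdry p : Om p -> ~ interior Om p -> bdry Om p.
Proof. by move=> Op iOp; split=> //; exact: subset_closure. Qed.

Lemma Om_scal (l : R) p : 1 <= l -> Om p -> Om (scal l p).
Proof.
case: Hi => _ [_ [_ [_ H]]]; rewrite le_eqVlt => /orP[/eqP <- |l1 Op].
  by rewrite /scal !mul1r -surjective_pairing.
by apply: (H _ l1); exists p.
Qed.

Lemma Om_neq0 p : Om p -> p != (0, 0).
Proof. by case: Hi => _ [_ [_ [H _]]] Op; apply/eqP => p0; apply: H; rewrite -p0. Qed.

Lemma bdry_scal_le1 (l : R) p : Om p -> bdry Om (scal l p) -> l <= 1.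
Proof.
move=> Op bp; rewrite leNgt; apply/negP => l1.
by have := Hs l1; rewrite -subset0 => /(_ (scal l p)); apply; split => //; exists p.
Qed.

Lemma scal_interior (l : R) p : 1 < l -> Om p -> interior Om (scal l p).
Proof.
move=> l1 Op; apply: contrapT => h.
have /(bdry_scal_le1 Op) : bdry Om (scal l p) by apply: mem_bdry => //; apply: Om_scal => //; exact: ltW.
by rewrite leNgt l1.
Qed.

(** A nonpositive factor would put the origin on the segment from [p] to [scal l p], hence in
    [Om]. *)
Lemma scal_mem_gt0 (l : R) p : Om p -> Om (scal l p) -> 0 < l.
Proof.
move=> Op Olp; rewrite ltNge; apply/negP => l0.
case: Hi => _ [cvx [_ [no0 _]]]; apply: no0.
have l1 : 0 < 1 - l by lra.
(* This weight of [p] is the one for which the convex combination is the origin. *)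
have := cvx p (scal l p) (- l / (1 - l)) Op Olp.
rewrite /scal/=; set X := (_, _).
have -> : X = (0, 0) by rewrite /X; congr pair; field; lra.
by apply; rewrite divr_ge0 ?ler_pdivrMr//=; lra.
Qed.

Lemma bdry_scal_ge1 (l : R) p : bdry Om p -> Om (scal l p) -> 1 <= l.
Proof.
move=> bp Olp; have l0 := scal_mem_gt0 (bdry_mem bp) Olp.
have := @bdry_scal_le1 l^-1 (scal l p) Olp.
rewrite scalA mulVf ?gt_eqF// /scal !mul1r -surjective_pairing => /(_ bp).
by rewrite invf_le1.
Qed.

Lemma Om_convex a b (s t : R) : Om a -> Om b -> 0 <= s -> 0 <= t -> s + t = 1 ->
  Om (s * a.1 + t * b.1, s * a.2 + t * b.2).
Proof.
case: Hi => _ [cvx _] Oa Ob s0 t0 st.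
rewrite (_ : t = 1 - s); last by lra.
by apply: cvx => //; lra.
Qed.

(* The ray through [b] meets the chord [a c] beyond [b]. *)
Lemma det2_superadditive a b c : Om a -> bdry Om b -> Om c ->
  0 <= det2 a b -> 0 <= det2 b c -> det2 a b + det2 b c <= det2 a c.
Proof.
move=> Oa bb Oc ab bc.
(* When both determinants vanish their sum cannot be a divisor; the linear relation then makes
   [det2 a c] times [b] zero, while [b] is not. *)
have [S0|S0] := eqVneq (det2 a b + det2 b c) 0.
  have [ab0 bc0] : det2 a b = 0 /\ det2 b c = 0 by split; lra.
  have := det2_jacobi a b c; rewrite ab0 bc0 /scal !mul0r addr0.
  move=> [] /eqP; rewrite mulf_eq0 => /orP[/eqP -> //|/eqP b1 /eqP].
  rewrite mulf_eq0 => /orP[/eqP -> //|/eqP b2].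
  by have /eqP[] := Om_neq0 (bdry_mem bb); rewrite (surjective_pairing b) b1 b2.
have Sp : 0 < det2 a b + det2 b c by rewrite lt_neqAle eq_sym S0 addr_ge0.
set S := det2 a b + det2 b c in S0 Sp *.
have : Om (scal (det2 a c / S) b).
  have -> : scal (det2 a c / S) b = (det2 b c / S * a.1 + det2 a b / S * c.1,
      det2 b c / S * a.2 + det2 a b / S * c.2).
    have [h1 h2] := det2_jacobi a b c.
    by rewrite /scal; congr pair; rewrite ![_ / S * _]mulrAC -mulrDl ?h1 ?h2.
  apply: Om_convex => //; try by rewrite divr_ge0// ltW.
  by rewrite -mulrDl [det2 b c + _]addrC divff.
by move=> /(bdry_scal_ge1 bb); rewrite ler_pdivlMr// mul1r.
Qed.

(** Parallel boundary points are multiples of each other, and [prop_star] leaves at most one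
    boundary point on each ray. *)
Lemma bdry_det2_eq0 a b : bdry Om a -> bdry Om b -> det2 a b = 0 -> a = b.
Proof.
move=> ba bb ab0.
have [k kE] : exists k, b = scal k a.
  have := Om_neq0 (bdry_mem ba).
  have [a1|a1 _] := eqVneq a.1 0.
    rewrite (surjective_pairing a) a1 xpair_eqE eqxx/= => a2.
    exists (b.2 / a.2); rewrite (surjective_pairing b) /scal/= mulr0 divfK//.
    move: ab0; rewrite /det2 a1 mul0r sub0r => /eqP.
    by rewrite oppr_eq0 mulf_eq0 (negbTE a2)/= => /eqP ->.
  exists (b.1 / a.1); rewrite (surjective_pairing b) /scal/= divfK//; congr pair.
  move: ab0; rewrite /det2 => /eqP; rewrite subr_eq0 => /eqP h.
  by rewrite mulrAC [b.1 * _]mulrC -h; field.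
have k1 : 1 <= k by apply: (bdry_scal_ge1 ba); rewrite -kE; exact: bdry_mem.
have k2 : k <= 1 by apply: (@bdry_scal_le1 _ a); rewrite -?kE//; exact: bdry_mem.
have -> : b = scal 1 a by rewrite kE; congr scal; lra.
by rewrite /scal !mul1r -surjective_pairing.
Qed.

Lemma continuous_scal p : continuous (fun l : R => scal l p).
Proof.
move=> l; have h (c : R) : (fun x : R => x * c) x @[x --> l] --> l * c.
  by apply: cvgM; [exact: cvg_id|exact: cvg_cst].
exact: (cvg_pair (h p.1) (h p.2)).
Qed.

(** The factor is the infimum of those keeping [p] in [Om]. It is attained because [Om] is closed,
    and at an interior point a smaller factor would still be admissible. *)
Lemma radial_bdry p : Om p -> exists l : R, [/\ 0 < l, l <= 1 & bdry Om (scal l p)].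
Proof.
move=> Op; case: (Hi) => _ [_ [cO [no0 _]]].
pose E := [set l : R | Om (scal l p)].
have E1 : E 1 by rewrite /E /= /scal !mul1r -surjective_pairing.
have cE : closed E.
  by apply: (@preimage_closed _ _ (fun l => scal l p)) => // l _; exact: continuous_scal.
have Elb l : E l -> 0 < l by exact: scal_mem_gt0.
have lbE : has_lbound E by exists 0 => l /Elb/ltW.
have El : E (inf E).
  apply: cE => B; rewrite -nbhs_ballE => -[d /= d0 dB].
  have [l El ld] := inf_adherent d0 (conj (ex_intro _ 1 E1) lbE).
  exists l; split=> //; apply: dB; have lE := ge_inf lbE El.
  by rewrite /ball/= distrC ger0_norm ?subr_ge0// ltrBlDl.
exists (inf E); split; [exact: Elb|exact: ge_inf|].
apply: mem_bdry => // iE.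
have : nbhs (inf E) [set l | Om (scal l p)].
  by apply: (@continuous_scal p (inf E)); rewrite /=.
rewrite -nbhs_ballE => -[d /= d0 h].
have : E (inf E - d / 2).
  by apply: h; rewrite /ball/= opprB addrCA subrr addr0 gtr0_norm; lra.
by move=> /(ge_inf lbE); lra.
Qed.

(** The point [scal 2 a] is interior, so it can be pushed sideways by a small multiple of the
    quarter turn of [a], then projected radially onto the boundary. *)
Lemma bdry_next a : bdry Om a -> exists2 b, bdry Om b & 0 < det2 a b.
Proof.
move=> ba; have Oa := bdry_mem ba.
have : nbhs (scal 2 a) Om by apply: scal_interior => //; lra.
rewrite -nbhs_ballE => -[d /= d0 h].
have a0 := sum_sqr_gt0 (Om_neq0 Oa).
(* This step size keeps both coordinates of the displacement below the radius [d]. *)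
pose k := d / (2 * (1 + `|a.1| + `|a.2|)).
have na : 0 < 1 + `|a.1| + `|a.2| by have := normr_ge0 a.1; have := normr_ge0 a.2; lra.
have k0 : 0 < k by rewrite divr_gt0// mulr_gt0.
have kd x : `|x| <= `|a.1| + `|a.2| -> `|k * x| < d.
  move=> hx; rewrite normrM gtr0_norm//; apply: (@le_lt_trans _ _ (k * (1 + `|a.1| + `|a.2|))).
    by rewrite ler_pM2l//; lra.
  by rewrite /k invfM mulrA mulfVK ?gt_eqF//; lra.
pose b := (2 * a.1 + k * (- a.2), 2 * a.2 + k * a.1).
have Ob : Om b.
  apply: h; split; rewrite /ball/= opprD addrA subrr sub0r normrN; apply: kd;
    by rewrite ?normrN; have := normr_ge0 a.1; have := normr_ge0 a.2; lra.
have [l [l0 _ bl]] := radial_bdry Ob.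
exists (scal l b) => //; rewrite det2Zr mulr_gt0// /b /det2/=.
by have := mulr_gt0 k0 a0; nra.
Qed.

(** Pushing [scal 2 a] away from a following boundary point [b] moves it clockwise. *)
Lemma bdry_prev a : bdry Om a -> exists2 b, bdry Om b & 0 < det2 b a.
Proof.
move=> ba; have Oa := bdry_mem ba; have [b bb ab] := bdry_next ba.
have : nbhs (scal 2 a) Om by apply: scal_interior => //; lra.
rewrite -nbhs_ballE => -[d /= d0 h].
have nb : 0 < 1 + `|b.1| + `|b.2| by have := normr_ge0 b.1; have := normr_ge0 b.2; lra.
pose k := d / (2 * (1 + `|b.1| + `|b.2|)).
have k0 : 0 < k by rewrite divr_gt0// mulr_gt0.
have kd x : `|x| <= `|b.1| + `|b.2| -> `|k * x| < d.
  move=> hx; rewrite normrM gtr0_norm//; apply: (@le_lt_trans _ _ (k * (1 + `|b.1| + `|b.2|))).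
    by rewrite ler_pM2l//; lra.
  by rewrite /k invfM mulrA mulfVK ?gt_eqF//; lra.
pose c := (2 * a.1 - k * b.1, 2 * a.2 - k * b.2).
have Oc : Om c.
  apply: h; split; rewrite /ball/= opprB addrC subrK; apply: kd;
    by have := normr_ge0 b.1; have := normr_ge0 b.2; lra.
have [l [l0 _ bl]] := radial_bdry Oc.
exists (scal l c) => //; rewrite det2Zl mulr_gt0//.
have -> : det2 c a = k * det2 a b by rewrite /c /det2/=; ring.
exact: mulr_gt0.
Qed.

End ConvexGeometry.

(** * Area of the sectors between boundary points *)

Section Sector.
Context {R : realType}.
Variable Om : set (R * R).
Hypotheses (Hi : prop_i Om) (Hs : prop_star Om).
Implicit Types (a b c e p q v : R * R).
Local Notation mu := (@lebesgue_measure R).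
Local Notation mu2 := (mu \x mu)%E.

Lemma cone2C a b : cone2 a b = cone2 b a.
Proof.
by apply/seteqP; split=> p [s] [t] [? [? ->]]; exists t, s; split=> //; split=> //;
  congr pair; rewrite addrC.
Qed.

Lemma sectorC a b : sector Om a b = sector Om b a.
Proof.
by apply/seteqP; split=> q [t] [p] [? [? [h ->]]]; exists t, p; split=> //; split=> //;
  split=> //; rewrite cone2C.
Qed.

Lemma cone2P a b p : 0 < det2 a b -> cone2 a b p <-> 0 <= det2 p b /\ 0 <= det2 a p.
Proof.
move=> ab; split.
  move=> [s] [t] [s0 [t0 ->]].
  have -> : det2 (s * a.1 + t * b.1, s * a.2 + t * b.2) b = s * det2 a b.
    by rewrite /det2/=; ring.
  have -> : det2 a (s * a.1 + t * b.1, s * a.2 + t * b.2) = t * det2 a b.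
    by rewrite /det2/=; ring.
  by split=> //; rewrite mulr_ge0// ltW.
move=> [h1 h2]; exists (det2 p b / det2 a b), (det2 a p / det2 a b); split.
  by rewrite divr_ge0// ltW.
split; first by rewrite divr_ge0// ltW.
have ab0 : a.1 * b.2 - a.2 * b.1 != 0 by rewrite -/(det2 a b) gt_eqF.
by rewrite {1}(surjective_pairing p) /det2; congr pair; field.
Qed.

Lemma cone2_scal (k : R) a b p : 0 <= k -> cone2 a b p -> cone2 a b (scal k p).
Proof.
move=> k0 [s] [t] [s0 [t0 ->]]; exists (k * s), (k * t).
by rewrite !mulr_ge0//; split=> //; split=> //; rewrite /scal/= !mulrDr !mulrA.
Qed.

Lemma cone2_bdry a b p : Om a -> Om b -> cone2 a b p -> p != (0, 0) ->
  exists2 k : R, 0 < k & bdry Om (scal k p).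
Proof.
move=> Oa Ob [s] [t] [s0 [t0 pE]] p0.
have st : 0 < s + t.
  rewrite lt_neqAle addr_ge0// andbT eq_sym; apply: contra p0.
  by rewrite paddr_eq0// pE => /andP[/eqP -> /eqP ->]; rewrite !mul0r addr0.
have Op : Om (scal (s + t)^-1 p).
  have -> : scal (s + t)^-1 p = (s / (s + t) * a.1 + t / (s + t) * b.1,
      s / (s + t) * a.2 + t / (s + t) * b.2).
    by rewrite pE /scal/=; congr pair; field; rewrite gt_eqF.
  apply: (Om_convex Hi) => //; try by rewrite divr_ge0// ltW.
  by rewrite -mulrDl divff ?gt_eqF.
have [l [l0 _ bl]] := radial_bdry Hi Op.
by exists (l * (s + t)^-1); rewrite -?scalA// mulr_gt0 ?invr_gt0.
Qed.

(** On each ray of the cone, the points up to the boundary are those outside the interior. This form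
    makes measurability and inclusions easy to check. *)
Lemma sectorE a b : bdry Om a -> bdry Om b ->
  sector Om a b = cone2 a b `&` ~` interior Om.
Proof.
move=> ba bb; apply/seteqP; split=> q.
  move=> [t] [p] [/andP[t0 t1] [bp [cp ->]]]; split; first exact: cone2_scal.
  move=> /= itp; have Otp := interior_subset itp.
  have tt : 1 <= t := bdry_scal_ge1 Hi Hs bp Otp.
  case: bp => _; apply; have -> : p = scal t p; last by [].
  by rewrite (_ : t = 1) /scal ?mul1r -?surjective_pairing//; lra.
move=> [cq iq]; have [->|q0] := eqVneq q (0, 0).
  exists 0, a; rewrite lexx ler01; split=> //; split=> //; split.
    by exists 1, 0; rewrite ler01 lexx; split=> //; split=> //; rewrite !mul1r !mul0r !addr0 -surjective_pairing.
  by rewrite /scal !mul0r.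
have [k k0 bk] := cone2_bdry (bdry_mem Hi ba) (bdry_mem Hi bb) cq q0.
have qE : q = scal k^-1 (scal k q).
  by rewrite scalA mulVf ?gt_eqF// /scal !mul1r -surjective_pairing.
exists k^-1, (scal k q); split; last first.
  by split=> //; split=> //; apply: cone2_scal => //; exact: ltW.
rewrite invr_ge0 ltW//= leNgt; apply/negP => k1; apply: iq.
by rewrite qE; apply: scal_interior => //; exact: bdry_mem.
Qed.

Lemma measurable_sector a b : bdry Om a -> bdry Om b -> 0 < det2 a b ->
  measurable (sector Om a b).
Proof.
move=> ba bb ab; rewrite sectorE//; apply: measurableI.
  rewrite (_ : cone2 a b = [set p | 0 <= b.2 * p.1 + (- b.1) * p.2] `&`
     [set p | 0 <= (- a.2) * p.1 + a.1 * p.2]).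
    by apply: measurableI; exact: measurable_halfplane.
  apply/seteqP; split=> p.
    by move/(cone2P _ ab); rewrite /det2 => -[? ?]; split=> /=; lra.
  by move=> [/= ? ?]; apply/(cone2P _ ab); rewrite /det2; split; lra.
by apply: measurableC; apply: open_plane_measurable; exact: open_interior.
Qed.

(** The chord from [a] to [b] lies in [Om], so each ray meets the boundary no later than the
    chord. *)
Lemma sector_sub_triangle a b : bdry Om a -> bdry Om b ->
  sector Om a b `<=` triangle a b.
Proof.
move=> ba bb _ [t] [p] [/andP[t0 t1] [bp [[x] [y] [x0 [y0 pE]] ->]]].
have xy : x + y <= 1.
  have [|xy] := leP (x + y) 0; first by lra.
  have Op : Om (scal (x + y)^-1 p).
    have -> : scal (x + y)^-1 p = (x / (x + y) * a.1 + y / (x + y) * b.1,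
        x / (x + y) * a.2 + y / (x + y) * b.2).
      by rewrite pE /scal/=; congr pair; field; rewrite gt_eqF.
    apply: (Om_convex Hi); try exact: bdry_mem; try by rewrite divr_ge0// ltW.
    by rewrite -mulrDl divff ?gt_eqF.
  by have := bdry_scal_ge1 Hi Hs bp Op; rewrite invf_ge1.
exists (t * x), (t * y); rewrite !mulr_ge0//; split=> //; first by rewrite -mulrDr mulr_ile1 ?addr_ge0.
by rewrite pE /scal/= !mulrDr !mulrA.
Qed.

Lemma sector_measure a b : bdry Om a -> bdry Om b -> 0 < det2 a b ->
  mu2 (sector Om a b) = (area (sector Om a b))%:E /\
  0 <= 2 * area (sector Om a b) <= det2 a b.
Proof.
move=> ba bb ab; have mS := measurable_sector ba bb ab.
have h : (mu2 (sector Om a b) <= (det2 a b / 2)%:E)%E.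
  rewrite -triangle_measure//; apply: le_measure; rewrite ?inE//.
    exact: measurable_triangle.
  exact: sector_sub_triangle.
have f : mu2 (sector Om a b) \is a fin_num.
  by rewrite ge0_fin_numE//; apply: le_lt_trans h _; rewrite ltry.
have E : mu2 (sector Om a b) = (area (sector Om a b))%:E by rewrite /area fineK.
split=> //; move: h; rewrite E lee_fin => h.
have : 0 <= area (sector Om a b) by rewrite fine_ge0.
lra.
Qed.

Lemma triangle_sub_sector a b c d : bdry Om a -> bdry Om b -> 0 < det2 a b ->
  0 < det2 c d -> triangle c d `<=` sector Om a b ->
  det2 c d <= 2 * area (sector Om a b).
Proof.
move=> ba bb ab cd sub; have [E _] := sector_measure ba bb ab.
have : (mu2 (triangle c d) <= mu2 (sector Om a b))%E.
  by apply: le_measure; rewrite ?inE//; [exact: measurable_triangle|exact: measurable_sector].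
by rewrite triangle_measure// E lee_fin; lra.
Qed.

Lemma interior_scal p : interior Om p -> exists l : R, [/\ 0 < l, l < 1 & Om (scal l p)].
Proof.
move=> ip; have [l [l0 l1 bl]] := radial_bdry Hi (interior_subset ip).
exists l; split=> //; last exact: bdry_mem.
rewrite lt_neqAle l1 andbT; apply/eqP => lE; case: bl => _; apply.
by rewrite lE /scal !mul1r -surjective_pairing.
Qed.

(** The line through [a] parallel to [e] meets the ray of [b] at [scal m b]. Superadditivity keeps
    [Om] on or beyond this line inside the cone, so the triangle below it lies in the sector. *)
Lemma sector_area_ge_prev e a b : Om e -> bdry Om a -> bdry Om b ->
  0 < det2 e a -> 0 < det2 a b ->
  det2 a b * det2 e a <= 2 * area (sector Om a b) * det2 e b.
Proof.
move=> Oe ba bb ea ab.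
have Ob := bdry_mem Hi bb.
have eb : 0 < det2 e b.
  by have := det2_superadditive Hi Hs Oe ba Ob (ltW ea) (ltW ab); lra.
pose m := det2 e a / det2 e b; have m0 : 0 < m by exact: divr_gt0.
rewrite -ler_pdivrMr// (_ : _ / _ = det2 a (scal m b)); last by rewrite det2Zr /m; ring.
apply: triangle_sub_sector => //; first by rewrite det2Zr mulr_gt0.
move=> q [s] [t] [s0 t0 st qE]; rewrite sectorE//; split.
  by exists s, (t * m); rewrite mulr_ge0 ?(ltW m0)//; split=> //; split=> //; rewrite qE /scal/= !mulrA.
(* An interior point could be shrunk by some [l < 1] within [Om]; superadditivity for [e], [a] and
   the shrunk point would then fail. *)
move=> /= /interior_scal[l [l0 l1 Olq]].
have aq : det2 a q = t * m * det2 a b by rewrite qE /det2 /=; ring.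
have eq : det2 e q = (s + t) * det2 e a.
  have -> : det2 e q = s * det2 e a + t * m * det2 e b by rewrite qE /det2 /=; ring.
  by rewrite -mulrA /m divfK ?gt_eqF//; ring.
have := det2_superadditive Hi Hs Oe ba Olq (ltW ea).
rewrite !det2Zr aq eq => /(_ (mulr_ge0 (ltW l0) (mulr_ge0 (mulr_ge0 t0 (ltW m0)) (ltW ab)))).
have : 0 <= l * (t * m * det2 a b).
  by rewrite mulr_ge0 ?(ltW l0)// mulr_ge0 ?(ltW ab)// mulr_ge0 ?(ltW m0).
move=> h1 h2; have : det2 e a <= l * (s + t) * det2 e a by rewrite -mulrA; lra.
rewrite ler_pMl// => ?.
have : l * (s + t) <= l by rewrite ger_pMr.
lra.
Qed.

(** Mirror image of the previous bound: the line through [b] parallel to [f] cuts off the triangle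
    with vertices at the origin, [scal m a] and [b]. *)
Lemma sector_area_ge_next f a b : Om f -> bdry Om a -> bdry Om b ->
  0 < det2 b f -> 0 < det2 a b ->
  det2 a b * det2 b f <= 2 * area (sector Om a b) * det2 a f.
Proof.
move=> Of ba bb bf ab.
have Oa := bdry_mem Hi ba.
have af : 0 < det2 a f.
  by have := det2_superadditive Hi Hs Oa bb Of (ltW ab) (ltW bf); lra.
pose m := det2 b f / det2 a f; have m0 : 0 < m by exact: divr_gt0.
rewrite -ler_pdivrMr// (_ : _ / _ = det2 (scal m a) b); last by rewrite det2Zl /m; ring.
apply: triangle_sub_sector => //; first by rewrite det2Zl mulr_gt0.
move=> q [s] [t] [s0 t0 st qE]; rewrite sectorE//; split.
  by exists (s * m), t; rewrite mulr_ge0 ?(ltW m0)//; split=> //; split=> //; rewrite qE /scal/= !mulrA.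
move=> /= /interior_scal[l [l0 l1 Olq]].
have qb : det2 q b = s * m * det2 a b by rewrite qE /det2 /=; ring.
have qf : det2 q f = (s + t) * det2 b f.
  have -> : det2 q f = s * m * det2 a f + t * det2 b f by rewrite qE /det2 /=; ring.
  by rewrite -mulrA /m divfK ?gt_eqF//; ring.
have h0 : 0 <= l * (s * m * det2 a b).
  by rewrite mulr_ge0 ?(ltW l0)// mulr_ge0 ?(ltW ab)// mulr_ge0 ?(ltW m0).
have := det2_superadditive Hi Hs Olq bb Of; rewrite !det2Zl qb qf => /(_ h0 (ltW bf)) h2.
have : det2 b f <= l * (s + t) * det2 b f by rewrite -mulrA; lra.
rewrite ler_pMl// => ?.
have : l * (s + t) <= l by rewrite ger_pMr.
lra.
Qed.

(** The two smaller sectors cover the large one and overlap only on the line through the origin and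
    [b], which has measure zero. *)
Lemma sector_area_add a b c : bdry Om a -> bdry Om b -> bdry Om c ->
  0 < det2 a b -> 0 < det2 b c ->
  area (sector Om a c) = area (sector Om a b) + area (sector Om b c).
Proof.
move=> ba bb bc ab bc0.
have ac : 0 < det2 a c.
  have := det2_superadditive Hi Hs (bdry_mem Hi ba) bb (bdry_mem Hi bc) (ltW ab) (ltW bc0).
  by lra.
have [E1 _] := sector_measure ba bb ab.
have [E2 _] := sector_measure bb bc bc0.
have [E3 _] := sector_measure ba bc ac.
have m1 := measurable_sector ba bb ab; have m2 := measurable_sector bb bc bc0.
have U : sector Om a c = sector Om a b `|` sector Om b c.
  rewrite !sectorE// -setIUl; congr setI.
  apply/seteqP; split=> p.
    move=> /(cone2P _ ac)[pc ap].
    have [bp|bp] := leP 0 (det2 b p); [right; apply/(cone2P _ bc0)|left; apply/(cone2P _ ab)]; split=> //.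
    by rewrite det2C oppr_ge0 ltW.
  (* Both identities test the linear relation of [a], [b], [c] against [p]; the signs they force put
     each small cone inside the large one. *)
  have J : det2 b c * det2 a p + det2 a b * det2 c p = det2 a c * det2 b p by rewrite /det2; ring.
  have J' : det2 a b * det2 p c = det2 b c * det2 a p - det2 a c * det2 b p by rewrite /det2; ring.
  move=> [/(cone2P _ ab)|/(cone2P _ bc0)] [h1 h2]; apply/(cone2P _ ac); split=> //.
    rewrite -(pmulr_rge0 _ ab) J'; move: h1; rewrite det2C oppr_ge0 => h1.
    have := mulr_ge0 (ltW bc0) h2; have := mulr_ge0_le0 (ltW ac) h1; lra.
  rewrite -(pmulr_rge0 _ bc0); have := mulr_ge0 (ltW ab) h1; have := mulr_ge0 (ltW ac) h2.
  lra.
have N : mu2 (sector Om a b `&` sector Om b c) = 0%E.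
  apply/eqP; rewrite eq_le measure_ge0 andbT.
  have mL := measurable_det2_line b.
  rewrite -(det2_line_null (Om_neq0 Hi (bdry_mem Hi bb))).
  apply: le_measure; rewrite ?inE//; first exact: measurableI.
  rewrite !sectorE// => p [[/(cone2P _ ab)[h1 h2] _] [/(cone2P _ bc0)[h3 h4] _]] /=.
  by move: h1; rewrite det2C oppr_ge0 => h1; apply/eqP; rewrite eq_le h1 h4.
have F1 : (mu2 (sector Om a b) < +oo)%E by rewrite E1 ltry.
have H : mu2 (sector Om a b `|` sector Om b c) =
    (mu2 (sector Om a b) + mu2 (sector Om b c) - mu2 (sector Om a b `&` sector Om b c))%E.
  by apply: measureUfinl => //; exact: F1.
by apply: EFin_inj; rewrite EFinD -E1 -E2 -E3 U H N sube0.
Qed.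
End Sector.

(** * Clamping real numbers to the unit interval *)

Section UnitClamp.
Context {R : realType}.
Implicit Types s : R.

Definition unit_clamp s : R := Num.max 0 (Num.min 1 s).

Lemma unit_clamp01 s : 0 <= unit_clamp s <= 1.
Proof. by rewrite le_max lexx/= ge_max ler01 ge_min lexx. Qed.

Lemma unit_clamp_id s : 0 <= s <= 1 -> unit_clamp s = s.
Proof. by move=> /andP[s0 s1]; rewrite /unit_clamp (min_idPr s1) (max_idPr s0). Qed.

Lemma unit_clamp_le s s' : s <= s' ->
  unit_clamp s <= unit_clamp s' /\ unit_clamp s' - unit_clamp s <= s' - s.
Proof.
by move=> ss; rewrite /unit_clamp; case: (leP 1 s) => h1; case: (leP 1 s') => h2;
  rewrite ?(max_idPr ler01); case: (leP 0 s) => h3; case: (leP 0 s') => h4; split; lra.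
Qed.
End UnitClamp.

(** * Boundary parameters that increase counterclockwise at most as fast as [det2] *)

Section BoundaryParameter.
Context {R : realType}.
Variables (Om : set (R * R)) (A : R * R -> R).
Hypotheses (Hi : prop_i Om) (Hs : prop_star Om).
Hypothesis HA : forall a b, bdry Om a -> bdry Om b -> 0 < det2 a b ->
  0 < A b - A a <= det2 a b.
Implicit Types (a b c e p q v : R * R).

Lemma param_lt a b : bdry Om a -> bdry Om b -> 0 < det2 a b -> A a < A b.
Proof. by move=> ba bb /(HA ba bb)/andP[+ _]; rewrite subr_gt0. Qed.

Lemma param_inj a b : bdry Om a -> bdry Om b -> A a = A b -> a = b.
Proof.
move=> ba bb h; have [ab|ba0|/esym] := ltgtP 0 (det2 a b).
- by have := param_lt ba bb ab; rewrite h ltxx.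
- have : 0 < det2 b a by rewrite det2C oppr_gt0.
  by move=> /(param_lt bb ba); rewrite h ltxx.
- exact: (bdry_det2_eq0 Hi Hs).
Qed.

Lemma det2_of_param_lt a b : bdry Om a -> bdry Om b ->
  A a < A b -> 0 < det2 a b.
Proof.
move=> ba bb h; have [//|ba0|/esym h0] := ltgtP 0 (det2 a b).
- have : 0 < det2 b a by rewrite det2C oppr_gt0.
  by move=> /(param_lt bb ba); rewrite ltNge (ltW h).
- by move: h; rewrite (bdry_det2_eq0 Hi Hs ba bb h0) ltxx.
Qed.

(* The radial projection of the chord [a b] onto the boundary makes [A]
   a Lipschitz function of the chord parameter. *)
Lemma param_ivt a b (t : R) : bdry Om a -> bdry Om b ->
  A a <= t <= A b -> exists2 p, bdry Om p & A p = t.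
Proof.
move=> ba bb /andP[ta tb].
have [ab|] := ltP (A a) (A b); last first.
  by move=> h; exists a => //; apply/le_anti; rewrite ta (le_trans tb h).
have {}ab := det2_of_param_lt ba bb ab.
pose z (s : R) := ((1 - s) * a.1 + s * b.1, (1 - s) * a.2 + s * b.2).
(* Outside the unit interval [l] is unconstrained; clamping the argument avoids those values and
   extends the curve to the whole line. *)
have /choice[l lP] s : exists l : R, 0 <= s <= 1 ->
    [/\ 0 < l, l <= 1 & bdry Om (scal l (z s))].
  have [/andP[s0 s1]|] := boolP (0 <= s <= 1); last by exists 0.
  have Oz : Om (z s) by apply: (Om_convex Hi); rewrite ?subr_ge0 ?subrK//; exact: bdry_mem.
  by have [l h] := radial_bdry Hi Oz; exists l.
pose cl := @unit_clamp R.
have cl01 s : 0 <= cl s <= 1 := unit_clamp01 s.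
have clE s : 0 <= s <= 1 -> cl s = s by exact: unit_clamp_id.
have cl_le s s' : s <= s' -> cl s <= cl s' /\ cl s' - cl s <= s' - s by exact: unit_clamp_le.
pose c s := scal (l s) (z s).
pose g s := A (c (cl s)).
have detc s s' : det2 (c s) (c s') = l s * (l s' * ((s' - s) * det2 a b)).
  by rewrite /c det2Zl det2Zr /z /det2/=; ring.
(* The radial factors [l] are at most 1, so determinants of projected points are at most those of
   the chord points. This gives the Lipschitz constant [det2 a b]. *)
have g_lip x y : x <= y -> 0 <= g y - g x <= (y - x) * det2 a b.
  move=> xy; have [h1 h2] := cl_le _ _ xy.
  have [lx0 lx1 bx] := lP _ (cl01 x); have [ly0 ly1 byy] := lP _ (cl01 y).
  have [e|ne] := eqVneq (cl x) (cl y).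
    by rewrite /g e subrr lexx/=; apply: mulr_ge0; [rewrite subr_ge0|exact: ltW].
  have {}h1 : 0 < cl y - cl x by rewrite subr_gt0 lt_neqAle ne.
  have d0 : 0 < det2 (c (cl x)) (c (cl y)) by rewrite detc !mulr_gt0.
  have /andP[h0 h] := HA bx byy d0; rewrite /g (ltW h0)/=.
  apply: (le_trans h); rewrite -/(c _) -/(c _) detc.
  have p0 : 0 <= (cl y - cl x) * det2 a b by rewrite mulr_ge0 ?ltW.
  apply: (@le_trans _ _ ((cl y - cl x) * det2 a b)); last by rewrite ler_pM2r.
  apply: (@le_trans _ _ (l (cl y) * ((cl y - cl x) * det2 a b))).
    by rewrite ler_piMl// mulr_ge0// ltW.
  by rewrite ler_piMl.
have cg : continuous g.
  move=> x; apply/cvgrPdist_lt => eps e0.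
  near=> y.
  have : `|x - y| < eps / det2 a b.
    near: y; apply/nbhs_ballP; exists (eps / det2 a b) => //=; exact: divr_gt0.
  rewrite ltr_pdivlMr// => h.
  have [xy|yx] := leP x y.
    have /andP[h1 h2] := g_lip _ _ xy.
    by rewrite distrC ger0_norm//; apply: le_lt_trans h2 _; move: h; rewrite distrC ger0_norm ?subr_ge0.
  have /andP[h1 h2] := g_lip _ _ (ltW yx).
  by rewrite ger0_norm//; apply: le_lt_trans h2 _; move: h; rewrite ger0_norm ?subr_ge0// ltW.
have g0 : g 0 = A a.
  have [_ _ bx] := lP _ (cl01 0); rewrite /g; congr A.
  by apply: (bdry_det2_eq0 Hi Hs) => //; rewrite /c clE ?lexx ?ler01// /z det2Zl /det2/=; ring.
have g1 : g 1 = A b.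
  have [_ _ bx] := lP _ (cl01 1); rewrite /g; congr A.
  by apply: (bdry_det2_eq0 Hi Hs) => //; rewrite /c clE ?lexx ?ler01// /z det2Zl /det2/=; ring.
have [s _ gs] : exists2 s, s \in `[0, 1] & g s = t.
  apply: IVT => //; first exact: continuous_subspaceT.
  by rewrite g0 g1 ge_min ta le_max tb orbT.
by exists (c (cl s)) => //; have [] := lP _ (cl01 s).
Unshelve. all: by end_near. Qed.

(** Boundary points before and after [a] enclose its parameter, and all intermediate values are
    taken. *)
Lemma param_open a : bdry Om a ->
  exists2 e : R, 0 < e & forall t, `|t - A a| < e -> exists2 p, bdry Om p & A p = t.
Proof.
move=> ba.
have [b bb ab] := bdry_next Hi Hs ba; have [c bc ca] := bdry_prev Hi Hs ba.
have h1 := param_lt ba bb ab; have h2 := param_lt bc ba ca.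
exists (Num.min (A b - A a) (A a - A c)); first by rewrite lt_min !subr_gt0 h1.
move=> t; rewrite lt_min !ltr_norml => /andP[/andP[_ h3] /andP[h4 _]].
by apply: (@param_ivt c b) => //; lra.
Qed.
End BoundaryParameter.

(** * The signed angle as a boundary parameter *)

Section Angle.
Context {R : realType}.
Variables (Om : set (R * R)) (w0 : R * R).
Hypotheses (Hi : prop_i Om) (Hs : prop_star Om) (bw0 : bdry Om w0).
Implicit Types (a b c e p q v : R * R).

Lemma angle_ccw b : 0 < det2 w0 b -> angle Om w0 b = 2 * area (sector Om w0 b).
Proof. by move=> h; rewrite /angle gtr0_sg// mul1r. Qed.

Lemma angle_cw b : 0 < det2 b w0 -> angle Om w0 b = - (2 * area (sector Om b w0)).
Proof.
by move=> h; rewrite /angle ltr0_sg ?mulN1r 1?sectorC// det2C oppr_lt0.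
Qed.

Lemma angle_base : angle Om w0 w0 = 0.
Proof. by rewrite /angle (_ : det2 w0 w0 = 0) ?sgr0 ?mul0r// /det2; ring. Qed.

(** The base point may come before, between or after [a] and [b]; with the orientation signs,
    additivity of sector areas gives the same difference in every case. *)
Lemma angle_diff a b : bdry Om a -> bdry Om b -> 0 < det2 a b ->
  angle Om w0 b - angle Om w0 a = 2 * area (sector Om a b).
Proof.
move=> ba bb ab.
have tr x y z : bdry Om x -> bdry Om y -> bdry Om z -> 0 < det2 x y -> 0 < det2 y z ->
    0 < det2 x z.
  move=> bx byy bz xy yz.
  by have := det2_superadditive Hi Hs (bdry_mem Hi bx) byy (bdry_mem Hi bz) (ltW xy) (ltW yz); lra.
have eqw x : bdry Om x -> det2 w0 x = 0 -> x = w0.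
  by move=> bx /(bdry_det2_eq0 Hi Hs bw0 bx).
have [wa|aw|/esym/(eqw _ ba) wa] := ltgtP 0 (det2 w0 a).
- have wb := tr _ _ _ bw0 ba bb wa ab.
  by rewrite !angle_ccw// (sector_area_add Hi Hs bw0 ba bb)// mulrDr addrAC subrr add0r.
- have {}aw : 0 < det2 a w0 by rewrite det2C oppr_gt0.
  have [wb|bw|/esym/(eqw _ bb) wb] := ltgtP 0 (det2 w0 b).
  + by rewrite angle_ccw// angle_cw// (sector_area_add Hi Hs ba bw0 bb)// mulrDr opprK addrC.
  + have {}bw : 0 < det2 b w0 by rewrite det2C oppr_gt0.
    by rewrite !angle_cw// (sector_area_add Hi Hs ba bb bw0)// mulrDr opprK addrCA addNr addr0.
  + by rewrite {1}wb angle_base angle_cw// wb sub0r opprK.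
- by rewrite wa angle_base subr0 angle_ccw// -wa.
Qed.

(** The upper bound comes from the triangle containing the sector. Strict positivity comes from a
    triangle inside it, built with a boundary point [e] preceding [a]. *)
Lemma angle_diff_bounds a b : bdry Om a -> bdry Om b -> 0 < det2 a b ->
  0 < angle Om w0 b - angle Om w0 a <= det2 a b.
Proof.
move=> ba bb ab; rewrite angle_diff//.
have [_ /andP[_ ->]] := sector_measure Hi Hs ba bb ab; rewrite andbT.
have [e be ea] := bdry_prev Hi Hs ba.
have Oe := bdry_mem Hi be.
have eb : 0 < det2 e b.
  by have := det2_superadditive Hi Hs Oe ba (bdry_mem Hi bb) (ltW ea) (ltW ab); lra.
by rewrite -(pmulr_lgt0 _ eb); apply: lt_le_trans (sector_area_ge_prev Hi Hs Oe ba bb ea ab); exact: mulr_gt0.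
Qed.

End Angle.

(** * Slopes of chords in a basis adapted to a boundary point *)

Section Slope.
Context {R : realType}.
Implicit Types (a d u v : R * R).

(** When [det2 a d = 1] these vectors, for varying [m], are exactly those with determinant 1 against
    [a]. *)
Definition slope_dir a d (m : R) : R * R := (m * a.1 + d.1, m * a.2 + d.2).

Lemma det2_slope_dir a d m v :
  det2 v (slope_dir a d m) = det2 v d - m * det2 a v.
Proof. by rewrite /det2/=; ring. Qed.

(** For [det2 a d = 1] and [v] not parallel to [a], the value of [m] that makes [slope_dir a d m]
    parallel to the chord from [a] to [v]. *)
Definition slope a d v : R := (det2 v d - 1) / det2 a v.

Lemma slopeK a d v : det2 a v != 0 -> slope a d v * det2 a v = det2 v d - 1.
Proof. by move=> h; rewrite /slope divfK. Qed.

Lemma slope_decomp a d v : det2 a d = 1 -> det2 a v != 0 ->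
  v.1 - a.1 = det2 a v * (slope a d v * a.1 + d.1) /\
  v.2 - a.2 = det2 a v * (slope a d v * a.2 + d.2).
Proof.
move=> ad av.
have E c b : det2 a v * (slope a d v * c + b) = (det2 v d - 1) * c + det2 a v * b.
  by rewrite -(slopeK d av); ring.
rewrite !E.
have e1 : v.1 = det2 a d * v.1 by rewrite ad mul1r.
have e2 : v.2 = det2 a d * v.2 by rewrite ad mul1r.
by split; [rewrite {1}e1|rewrite {1}e2]; rewrite /det2; ring.
Qed.

(** Through this identity superadditivity of [det2] becomes monotonicity of slopes. *)
Lemma det2_slopes a d u v : det2 a d = 1 -> det2 a u != 0 -> det2 a v != 0 ->
  det2 u v = det2 a v - det2 a u + det2 a u * det2 a v * (slope a d u - slope a d v).
Proof.
move=> ad au av.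
have -> : det2 a u * det2 a v * (slope a d u - slope a d v) =
   det2 a v * (slope a d u * det2 a u) - det2 a u * (slope a d v * det2 a v) by ring.
rewrite !slopeK// -[LHS]mul1r -{1}ad /det2; ring.
Qed.
End Slope.

(** * The antipolar set and its properties *)

Section Antipolar.
Context {R : realType}.
Variable Om : set (R * R).
Hypotheses (Hi : prop_i Om).
Implicit Types (p q u v w z : R * R).

Lemma continuous_pairing (c d : R) : continuous (fun p : R * R => c * p.1 + d * p.2).
Proof.
move=> p; apply: cvgD; apply: cvgM; try exact: cvg_cst; [exact: cvg_fst|exact: cvg_snd].
Qed.

Lemma closed_halfplane (c d e : R) : closed [set p : R * R | e <= c * p.1 + d * p.2].
Proof.
apply: (@preimage_closed _ _ (fun p : R * R => c * p.1 + d * p.2) [set x : R | e <= x]).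
  by move=> p _; exact: continuous_pairing.
exact: closed_ge.
Qed.

Lemma antipolarE : antipolar Om =
  \bigcap_(v in Om) [set w : R * R | 1 <= v.1 * w.1 + (- v.2) * w.2].
Proof.
by apply/seteqP; split=> w H v Ov; have := H v Ov => /=; rewrite mulNr ![v.1 * _]mulrC ![v.2 * _]mulrC.
Qed.

Lemma antipolar_prop_i : antipolar Om !=set0 -> prop_i (antipolar Om).
Proof.
move=> A0; split=> //; split.
  move=> a b t Aa Ab /andP[t0 t1] v Ov /=; have := Aa v Ov; have := Ab v Ov.
  move=> h1 h2; have : t * 1 + (1 - t) * 1 <= t * (a.1 * v.1 - a.2 * v.2) + (1 - t) * (b.1 * v.1 - b.2 * v.2).
    by apply: lerD; apply: ler_wpM2l => //; lra.
  by lra.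
split; first by rewrite antipolarE; apply: closed_bigI => v _; exact: closed_halfplane.
split.
  case: Hi => -[v Ov] _ /(_ v Ov) /=; rewrite !mul0r subrr.
  by rewrite leNgt ltr01.
move=> l l1 _ [w Aw <-] v Ov /=; have := Aw v Ov.
set x := w.1 * v.1 - w.2 * v.2 => x1.
have -> : l * w.1 * v.1 - l * w.2 * v.2 = l * x by rewrite /x; ring.
by apply: (le_trans x1); rewrite ler_peMl//; lra.
Qed.

(** Shrinking [w] slightly would lower its pairing with [v] below 1, so [w] is not interior. *)
Lemma antipolar_bdry w v : antipolar Om w -> Om v -> w.1 * v.1 - w.2 * v.2 = 1 ->
  bdry (antipolar Om) w.
Proof.
move=> Aw Ov wv; split; first exact: subset_closure.
move=> iw.
have : nbhs (1 : R) [set l | antipolar Om (scal l w)].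
  by apply: (@continuous_scal _ w 1); rewrite /= /scal !mul1r -surjective_pairing.
rewrite -nbhs_ballE => -[d /= d0 h].
have : antipolar Om (scal (1 - d / 2) w).
  by apply: h; rewrite /ball/= opprB addrCA subrr addr0 gtr0_norm; lra.
move=> /(_ v Ov) /=.
have -> : (1 - d / 2) * w.1 * v.1 - (1 - d / 2) * w.2 * v.2 = (1 - d / 2) * (w.1 * v.1 - w.2 * v.2) by ring.
by rewrite wv; lra.
Qed.

Lemma plane_norm p : `|p.1| <= `|p| /\ `|p.2| <= `|p|.
Proof. by rewrite prod_normE !le_max !lexx orbT. Qed.

Lemma plane_norm_gt0 p : p != (0, 0) -> 0 < `|p|.
Proof. by move=> p0; rewrite normr_gt0. Qed.

Lemma compact_unit_sphere (C : set (R * R)) : closed C -> compact (C `&` [set p | `|p| = 1]).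
Proof.
move=> cC.
have cS : closed (C `&` [set p : R * R | `|p| = 1]).
  apply: closedI => //.
  apply: (@preimage_closed _ _ (fun p : R * R => `|p|) [set (1 : R)]); last exact: closed_eq.
  by move=> p _; exact: norm_continuous.
have cB := compact_setX (@segment_compact R (-1) 1) (@segment_compact R (-1) 1).
rewrite (_ : _ `&` _ = (`[-1, 1] `*` `[-1, 1]) `&` (C `&` [set p : R * R | `|p| = 1])).
  exact: compact_closedI.
rewrite setIC; apply/seteqP; split=> p; last by move=> [_ []].
move=> [p1 Cp]; split; last by split.
by have [h1 h2] := plane_norm p; split; rewrite /= in_itv/= -ler_norml -p1.
Qed.

Lemma antipolar_cone_ge0 w u : antipolar Om w -> cone_hull Om u -> 0 <= w.1 * u.1 - w.2 * u.2.
Proof.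
move=> Aw; have cH := @closed_halfplane w.1 (- w.2) 0.
suff : cone_hull Om `<=` [set p | 0 <= w.1 * p.1 + (- w.2) * p.2].
  by move=> H /H /=; rewrite mulNr.
move=> q Cq; apply: cH; move: q Cq; apply: closure_subset.
move=> _ [t] [v] [t0 [Ov ->]] /=; have := Aw v Ov => h.
rewrite (_ : _ + _ = t * (w.1 * v.1 - w.2 * v.2)); last by ring.
by apply: mulr_ge0 => //; apply: le_trans h.
Qed.

(* A functional of the antipolar vanishing at [u] would vanish on a boundary
   ray of the cone, to which [Om] comes arbitrarily close. *)
Lemma antipolar_cone_gt0 w u : prop_2star Om -> antipolar Om w ->
  cone_hull Om u -> u != (0, 0) -> 0 < w.1 * u.1 - w.2 * u.2.
Proof.
move=> [u0 [u1 [_ [_ [bC [d0 d1]]]]]] Aw Cu un.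
rewrite lt_neqAle (antipolar_cone_ge0 Aw Cu) andbT; apply/eqP => wu.
have w0 : w != (0, 0).
  apply/eqP => w0; case: Hi => -[v Ov] _.
  by have := Aw v Ov; rewrite w0 /= !mul0r subrr leNgt ltr01.
have ww := sum_sqr_gt0 w0.
(* Moving [u] by a small multiple of [(- w.1, w.2)] would make its pairing with [w] negative, so no
   neighbourhood of [u] lies in the cone. *)
have : bdry (cone_hull Om) u.
  split; first exact: subset_closure.
  rewrite /interior -nbhs_ballE => -[d /= dp h].
  pose n := 1 + `|w.1| + `|w.2|.
  have n0 : 0 < n by rewrite /n; have := normr_ge0 w.1; have := normr_ge0 w.2; lra.
  pose k := d / (2 * n).
  have k0 : 0 < k by rewrite divr_gt0// mulr_gt0.
  have kd (x : R) : `|x| <= n -> `|k * x| < d.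
    move=> hx; rewrite normrM gtr0_norm//; apply: (@le_lt_trans _ _ (k * n)).
      by rewrite ler_pM2l.
    by rewrite /k invfM mulrA mulfVK ?gt_eqF//; lra.
  have : cone_hull Om (u.1 - k * w.1, u.2 + k * w.2).
    apply: h; split; rewrite /ball/=.
      by rewrite opprB addrC subrK; apply: kd; rewrite /n; have := normr_ge0 w.2; lra.
    by rewrite opprD addrA subrr sub0r normrN; apply: kd; rewrite /n; have := normr_ge0 w.1; lra.
  move=> /(antipolar_cone_ge0 Aw) /=.
  have -> : w.1 * (u.1 - k * w.1) - w.2 * (u.2 + k * w.2) =
     (w.1 * u.1 - w.2 * u.2) - k * (w.1 ^+ 2 + w.2 ^+ 2) by ring.
  by rewrite -wu sub0r oppr_ge0 leNgt mulr_gt0.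
(* The pairing with [w] vanishes on the ray, so at a point [v] of [Om] close enough to the ray it
   cannot reach 1. *)
have key r : dist_zero (ray r) Om -> ray r u -> False.
  move=> dr [t [t0 uE]].
  have tn : t != 0 by apply: contraNneq un => tE; rewrite uE tE /scal !mul0r.
  have wr : w.1 * r.1 - w.2 * r.2 = 0.
    have : t * (w.1 * r.1 - w.2 * r.2) = 0.
      by rewrite [RHS]wu uE /=; ring.
    by move/eqP; rewrite mulf_eq0 (negbTE tn)/= => /eqP.
  pose n := 1 + `|w.1| + `|w.2|.
  have n0 : 0 < n by rewrite /n; have := normr_ge0 w.1; have := normr_ge0 w.2; lra.
  have [|p [v [[s [s0 pE]] [Ov [h1 h2]]]]] := dr (n^-1); first by rewrite invr_gt0.
  have := Aw v Ov.
  have -> : w.1 * v.1 - w.2 * v.2 = w.2 * (p.2 - v.2) - w.1 * (p.1 - v.1).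
    rewrite pE /=; transitivity (w.1 * v.1 - w.2 * v.2 - s * (w.1 * r.1 - w.2 * r.2)).
      by rewrite wr mulr0 subr0.
    by ring.
  move=> h3.
  have : 1 <= (`|w.2| + `|w.1|) * n^-1.
    apply: (le_trans h3); apply: (le_trans (ler_norm _)); apply: (le_trans (ler_normB _ _)).
    by rewrite mulrDl !normrM lerD// ler_wpM2l// ltW.
  by rewrite ler_pdivlMr// mul1r /n; lra.
by rewrite bC => -[]; exact: key.
Qed.

(** The pairing with [w] has a positive minimum on the compact set of unit vectors of the cone;
    homogeneity gives the rest. *)
Lemma antipolar_coercive w : prop_2star Om -> antipolar Om w ->
  exists2 c : R, 0 < c & forall v, Om v -> c * `|v| <= w.1 * v.1 - w.2 * v.2.
Proof.
move=> H2 Aw; pose K := cone_hull Om `&` [set p : R * R | `|p| = 1].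
have normK v : Om v -> K (scal `|v|^-1 v).
  move=> Ov; have v0 : 0 < `|v| by apply: plane_norm_gt0; exact: (Om_neq0 Hi).
  split; first by apply: subset_closure; exists `|v|^-1, v; rewrite invr_ge0.
  rewrite /= (_ : scal _ v = `|v|^-1 *: v)//.
  by rewrite normrZ gtr0_norm ?invr_gt0// mulVf// gt_eqF.
have K0 : K !=set0 by case: Hi => -[v Ov] _; exists (scal `|v|^-1 v); exact: normK.
have cK : compact K by apply: compact_unit_sphere; exact: closed_closure.
have [c cK0 cmin] := compact_EVT_min K0 cK
  (@continuous_subspaceT _ _ K _ (@continuous_pairing w.1 (- w.2))).
have [Cc c1] := set_mem cK0.
exists (w.1 * c.1 + - w.2 * c.2).
  rewrite mulNr; apply: antipolar_cone_gt0 => //.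
  by rewrite -normr_gt0 c1 ltr01.
move=> v Ov; have v0 : 0 < `|v| by apply: plane_norm_gt0; exact: (Om_neq0 Hi).
have := cmin _ (mem_set (normK _ Ov)); rewrite /= => h.
rewrite -ler_pdivlMr//; apply: (le_trans h).
by rewrite le_eqVlt; apply/orP; left; apply/eqP; ring.
Qed.

(** Scaling [w] by [l > 1] leaves a margin proportional to the norm of [v], which absorbs a small
    perturbation uniformly over [Om]; the scaled point is therefore interior. *)
Lemma antipolar_prop_star : prop_2star Om -> prop_star (antipolar Om).
Proof.
move=> H2 l l1; rewrite -subset0 => _ [[w Aw <-] [_]]; apply.
have [c c0 cP] := antipolar_coercive H2 Aw.
(* Half of the margin is reserved for each coordinate. *)
rewrite /interior -nbhs_ballE; exists ((l - 1) * c / 2) => /=.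
  by rewrite divr_gt0// mulr_gt0// subr_gt0.
move=> z [/= z1 z2] v Ov.
have h1 := Aw v Ov; have h2 := cP v Ov; have [n1 n2] := plane_norm v.
move: z1 z2; rewrite /ball/=; set d := _ / 2 => z1 z2.
set x1 := l * w.1 - z.1 in z1; set x2 := l * w.2 - z.2 in z2.
have -> : z.1 * v.1 - z.2 * v.2 = l * (w.1 * v.1 - w.2 * v.2) - (x1 * v.1 - x2 * v.2).
  by rewrite /x1 /x2; ring.
have b : x1 * v.1 - x2 * v.2 <= (l - 1) * (c * `|v|).
  apply: (le_trans (ler_norm _)); apply: (le_trans (ler_normB _ _)); rewrite !normrM.
  have -> : (l - 1) * (c * `|v|) = d * `|v| + d * `|v| by rewrite /d; field.
  by apply: lerD; apply: ler_pM => //; exact: ltW.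
have : (l - 1) * (c * `|v|) <= (l - 1) * (w.1 * v.1 - w.2 * v.2).
  by rewrite ler_pM2l// subr_gt0.
by lra.
Qed.
End Antipolar.

(** * One-sided derivatives, and density of the rational points of the plane *)

Section OneSidedDerivatives.
Context {R : realType}.
Implicit Types (f : R -> R) (x l r m c b : R).

Lemma is_derive_one_sided f x l : left_deriv f x l -> right_deriv f x l -> is_derive x 1 f l.
Proof.
move=> fl fr.
have lim1 : (fun h : R => h^-1 * (f (x + h) - f x)) @ 0^' --> l.
  exact: (@cvg_at_right_left_dnbhs R R^o _ 0 l fr fl).
have lim0 : (fun h : R => h^-1 *: ((f \o shift x) (h *: 1) - f x)) @ 0^' --> l.
  rewrite (_ : (fun h : R => _) = (fun h => h^-1 * (f (x + h) - f x)))//.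
  by apply/funext => h; rewrite /= /GRing.scale/= mulr1 [h + x]addrC.
by apply: DeriveDef; [exact: cvgP lim0|exact: cvg_lim].
Qed.

Lemma left_deriv_unique f x l r : left_deriv f x l -> left_deriv f x r -> l = r.
Proof. by move=> h1 h2; apply: (cvg_unique _ h1 h2). Qed.

Lemma right_deriv_unique f x l r : right_deriv f x l -> right_deriv f x r -> l = r.
Proof. by move=> h1 h2; apply: (cvg_unique _ h1 h2). Qed.

Lemma between_affine (Mm Mp m c b : R) : Mm <= m <= Mp ->
  between (Mm * c + b) (Mp * c + b) (m * c + b).
Proof.
move=> /andP[h1 h2]; rewrite /between ge_min le_max !lerD2r.
have [c0|/ltW c0] := leP 0 c.
  by rewrite (ler_wpM2r c0 h1) (ler_wpM2r c0 h2) orbT.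
by rewrite (ler_wnM2r c0 h1) (ler_wnM2r c0 h2) orbT.
Qed.

Lemma rat_plane_dense (P : set (R * R)) (p : R * R) : nbhs p P ->
  exists q : rat * rat, P (ratr q.1, ratr q.2).
Proof.
rewrite -nbhs_ballE => -[e /= e0 h].
have [q1] := @rat_in_itvoo R (p.1 - e) (p.1 + e) ltac:(lra).
have [q2] := @rat_in_itvoo R (p.2 - e) (p.2 + e) ltac:(lra).
rewrite !in_itv/= => /andP[h1 h2] /andP[h3 h4].
by exists (q1, q2); apply: h; split; rewrite /ball/= ltr_norml; lra.
Qed.
End OneSidedDerivatives.

(** * Regularity, one-sided derivatives and corners of a parametrised boundary *)

Section Curve.
Context {R : realType}.
Variables (Om : set (R * R)) (D : set R) (w : R -> R * R).
Hypotheses (Hi : prop_i Om) (Hs : prop_star Om).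
Hypothesis Dopen : forall x, D x -> exists2 e : R, 0 < e & forall t, `|t - x| < e -> D t.
Hypothesis wb : forall t, D t -> bdry Om (w t).
Hypothesis det_ge : forall s t, D s -> D t -> s < t -> t - s <= det2 (w s) (w t).
Hypothesis det_le_prev : forall e s t, D e -> D s -> D t -> e < s -> s < t ->
  det2 (w s) (w t) * det2 (w e) (w s) <= (t - s) * det2 (w e) (w t).
Hypothesis det_le_next : forall s t f, D s -> D t -> D f -> s < t -> t < f ->
  det2 (w s) (w t) * det2 (w t) (w f) <= (t - s) * det2 (w s) (w f).
Implicit Types (s t x : R).

Lemma curve_det_gt0 s t : D s -> D t -> s < t -> 0 < det2 (w s) (w t).
Proof. by move=> Ds Dt st; apply: lt_le_trans (det_ge Ds Dt st); rewrite subr_gt0. Qed.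

Lemma curve_super s t u : D s -> D t -> D u -> s < t -> t < u ->
  det2 (w s) (w t) + det2 (w t) (w u) <= det2 (w s) (w u).
Proof.
move=> Ds Dt Du st tu.
apply: (det2_superadditive Hi Hs (bdry_mem Hi (wb Ds)) (wb Dt) (bdry_mem Hi (wb Du)));
  by apply: ltW; exact: curve_det_gt0.
Qed.

(* With [E], [F] two points of the curve around [w s], [w t], the nonnegative
   numbers [det2 E (w t - w s)] and [det2 F (w t - w s)] have a positive
   combination equal to [det2 (w s) (w t)], which is of order [t - s]. *)
Lemma chord_bound (E F ws wt : R * R) (Q h de : R) : 0 < de -> 0 < h -> Q = det2 E F ->
  de <= det2 E ws -> de <= det2 wt F -> 0 <= det2 ws wt ->
  det2 ws wt * det2 E ws <= h * det2 E wt ->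
  det2 E ws + det2 ws wt <= det2 E wt -> det2 ws wt + det2 wt F <= det2 ws F ->
  det2 E wt + det2 wt F <= Q ->
  [/\ 0 < Q, `|Q * (wt.1 - ws.1)| <= (`|E.1| + `|F.1|) * (Q ^+ 2 / de ^+ 2 * h) &
   `|Q * (wt.2 - ws.2)| <= (`|E.2| + `|F.2|) * (Q ^+ 2 / de ^+ 2 * h)].
Proof.
move=> de0 h0 QE E1 F1 st0 low k1 k2 k3.
have Q0 : 0 < Q by lra.
pose x1 := det2 E wt - det2 E ws; pose x2 := det2 ws F - det2 wt F.
have x10 : 0 <= x1 by rewrite /x1; lra.
have x20 : 0 <= x2 by rewrite /x2; lra.
have Id : Q * det2 ws wt = det2 ws F * x1 + det2 E ws * x2.
  by rewrite QE /x1 /x2 /det2; ring.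
have b1 : de * det2 ws wt <= h * Q.
  apply: (@le_trans _ _ (det2 ws wt * det2 E ws)); first by rewrite mulrC ler_wpM2l.
  by apply: (le_trans low); rewrite ler_pM2l//; lra.
have b2 : de * (x1 + x2) <= Q * det2 ws wt.
  by rewrite Id mulrDr; apply: lerD; apply: ler_wpM2r => //; lra.
have b3 : x1 + x2 <= Q ^+ 2 / de ^+ 2 * h.
  rewrite mulrAC ler_pdivlMr ?exprn_gt0// mulrC expr2 -mulrA.
  apply: (@le_trans _ _ (de * (Q * det2 ws wt))); first by rewrite ler_pM2l.
  by rewrite mulrCA expr2 -mulrA ler_pM2l// [Q * h]mulrC.
have X1 : 0 <= x1 <= Q ^+ 2 / de ^+ 2 * h by lra.
have X2 : 0 <= x2 <= Q ^+ 2 / de ^+ 2 * h by lra.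
(* By Cramer's rule [Q] times the chord vector is [x1] times [F] minus [x2] times [E]. *)
have comp (u v z : R) : z = x1 * v - x2 * u -> `|z| <= (`|u| + `|v|) * (Q ^+ 2 / de ^+ 2 * h).
  move=> ->; apply: (le_trans (ler_normB _ _)); rewrite !normrM (ger0_norm x10) (ger0_norm x20).
  case/andP: X1 => _ X1; case/andP: X2 => _ X2; rewrite [X in _ <= X]mulrDl addrC.
  by apply: lerD; rewrite mulrC ler_wpM2l.
by split=> //; apply: comp; rewrite QE /x1 /x2 /det2; ring.
Qed.

Lemma curve_lipschitz x : D x -> exists e k : R, 0 < e /\ forall s t, D s -> D t ->
  `|s - x| < e -> `|t - x| < e ->
  `|(w s).1 - (w t).1| <= k * `|s - t| /\ `|(w s).2 - (w t).2| <= k * `|s - t|.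
Proof.
move=> Dx; have [e e0 He] := Dopen Dx.
(* Points within [e / 4] of [x] keep a parameter distance of at least [e / 4] from [E] and [F],
   which [det_ge] converts into the lower bound [de]. *)
pose E := x - e / 2; pose F := x + e / 2.
have DE : D E by apply: He; rewrite /E addrAC subrr sub0r normrN gtr0_norm; lra.
have DF : D F by apply: He; rewrite /F addrAC subrr add0r gtr0_norm; lra.
pose Q := det2 (w E) (w F); pose de := e / 4.
have de0 : 0 < de by rewrite /de; lra.
have EF : E < F by rewrite /E /F; lra.
have Q0 : 0 < Q by exact: curve_det_gt0.
pose c := Q ^+ 2 / de ^+ 2.
have c0 : 0 <= c by rewrite divr_ge0 ?sqr_ge0.
pose k1 := (`|(w E).1| + `|(w F).1|) * c / Q; pose k2 := (`|(w E).2| + `|(w F).2|) * c / Q.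
have k10 : 0 <= k1 by rewrite divr_ge0 ?(ltW Q0)// mulr_ge0// addr_ge0.
have k20 : 0 <= k2 by rewrite divr_ge0 ?(ltW Q0)// mulr_ge0// addr_ge0.
exists de, (k1 + k2); split=> //.
have main s t : D s -> D t -> `|s - x| < de -> `|t - x| < de -> s < t ->
  `|(w s).1 - (w t).1| <= (k1 + k2) * (t - s) /\ `|(w s).2 - (w t).2| <= (k1 + k2) * (t - s).
  move=> Ds Dt; rewrite !ltr_norml => /andP[s1 s2] /andP[t1 t2] st.
  have Es : E < s by move: s1; rewrite /E /de; lra.
  have tF : t < F by move: t2; rewrite /F /de; lra.
  have Et := lt_trans Es st; have sF := lt_trans st tF.
  have h0 : 0 < t - s by rewrite subr_gt0.
  have dE : de <= det2 (w E) (w s).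
    by apply: le_trans (det_ge DE Ds Es); move: s1; rewrite /E /de; lra.
  have dF : de <= det2 (w t) (w F).
    by apply: le_trans (det_ge Dt DF tF); move: t2; rewrite /F /de; lra.
  have [_ h1 h2] := @chord_bound (w E) (w F) (w s) (w t) Q (t - s) de de0 h0 erefl dE dF
     (ltW (curve_det_gt0 Ds Dt st)) (det_le_prev DE Ds Dt Es st) (curve_super DE Ds Dt Es st)
     (curve_super Ds Dt DF st tF) (curve_super DE Dt DF Et tF).
  rewrite -/c in h1 h2; rewrite ![`|_ - _ (w t)|]distrC.
  have d1 : `|(w t).1 - (w s).1| <= k1 * (t - s).
    move: h1; rewrite normrM gtr0_norm// mulrC -ler_pdivlMr// => h1.
    by apply: le_trans h1 _; rewrite /k1 mulrA mulrAC.
  have d2 : `|(w t).2 - (w s).2| <= k2 * (t - s).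
    move: h2; rewrite normrM gtr0_norm// mulrC -ler_pdivlMr// => h2.
    by apply: le_trans h2 _; rewrite /k2 mulrA mulrAC.
  split; [apply: (le_trans d1)|apply: (le_trans d2)]; by rewrite ler_pM2r ?lerDl ?lerDr.
move=> s t Ds Dt hs ht; have [st|ts|->] := ltgtP s t.
- by rewrite [`|s - t|]distrC [`|t - s|]gtr0_norm ?subr_gt0//; exact: main.
- have [h1 h2] := main _ _ Dt Ds ht hs ts.
  by rewrite [`|s - t|]gtr0_norm ?subr_gt0//; split; rewrite distrC.
- by rewrite !subrr normr0 mulr0.
Qed.

Lemma curve_slope_le x d s t : D x -> det2 (w x) d = 1 -> D s -> D t -> s < t ->
  s != x -> t != x -> slope (w x) d (w s) <= slope (w x) d (w t).
Proof.
move=> Dx xd Ds Dt st sx tx.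
have sg y : D y -> y != x ->
    (y < x /\ det2 (w x) (w y) < 0) \/ (x < y /\ 0 < det2 (w x) (w y)).
  move=> Dy yx; have [yltx|xlty|yE] := ltgtP y x.
  - by left; split=> //; rewrite det2C oppr_lt0; exact: curve_det_gt0.
  - by right; split=> //; exact: curve_det_gt0.
  - by rewrite yE eqxx in yx.
have ne y : D y -> y != x -> det2 (w x) (w y) != 0.
  by move=> Dy yx; case: (sg _ Dy yx) => -[_ h]; [rewrite lt_eqF|rewrite gt_eqF].
have := det2_slopes xd (ne _ Ds sx) (ne _ Dt tx).
set al := det2 (w x) (w s); set be := det2 (w x) (w t).
set ms := slope _ _ (w s); set mt := slope _ _ (w t) => E.
rewrite -subr_le0.
(* Superadditivity is applied to [s], [t], [x] in the order of their parameters; the signs of [al]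
   and [be] turn it into the same inequality of slopes each time. *)
case: (sg _ Ds sx) => -[h1 h2]; case: (sg _ Dt tx) => -[h3 h4].
- have := curve_super Ds Dt Dx st h3.
  rewrite E [det2 (w t) (w x)]det2C [det2 (w s) (w x)]det2C -/al -/be => K.
  by rewrite -(nmulr_rge0 _ (_ : be < 0))// -(nmulr_rle0 _ (_ : al < 0))// mulrA; lra.
- have := curve_super Ds Dx Dt h1 h3.
  rewrite E [det2 (w s) (w x)]det2C -/al -/be => K.
  by rewrite -(pmulr_rle0 _ (_ : 0 < be))// -(nmulr_rge0 _ (_ : al < 0))// mulrA; lra.
- by have := lt_trans h1 st; rewrite ltNge (ltW h3).
- have := curve_super Dx Ds Dt h1 st; rewrite E -/al -/be => K.
  by rewrite -(pmulr_rle0 _ (_ : 0 < be))// -(pmulr_rle0 _ (_ : 0 < al))// mulrA; lra.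
Qed.

Lemma curve_continuous x : D x ->
  (fun h => (w (x + h)).1) @ 0 --> (w x).1 /\ (fun h => (w (x + h)).2) @ 0 --> (w x).2.
Proof.
move=> Dx; have [e [k [e0 H]]] := curve_lipschitz Dx; have [d d0 Hd] := Dopen Dx.
have aux (f : R * R -> R) : (forall s t, D s -> D t -> `|s - x| < e -> `|t - x| < e ->
    `|f (w s) - f (w t)| <= k * `|s - t|) -> (fun h => f (w (x + h))) @ 0 --> f (w x).
  move=> Hf; apply/cvgrPdist_lt => eps eps0.
  have hb (y : R) : 0 < y -> \forall h \near (0 : R), `|h| < y.
    by move=> y0; apply/nbhs_ballP; exists y => //= z; rewrite /ball/= sub0r normrN.
  have k0 : 0 < `|k| + 1 by have := normr_ge0 k; lra.
  near=> h.
  have hd : `|x + h - x| < d by rewrite addrAC subrr add0r; near: h; exact: hb.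
  have he : `|x + h - x| < e by rewrite addrAC subrr add0r; near: h; exact: hb.
  apply: (le_lt_trans (Hf x (x + h) Dx (Hd _ hd) _ he)); first by rewrite subrr normr0.
  rewrite opprD addrA subrr sub0r normrN.
  apply: (@le_lt_trans _ _ ((`|k| + 1) * `|h|)).
    by apply: ler_wpM2r => //; have := ler_norm k; lra.
  by rewrite mulrC -ltr_pdivlMr//; near: h; apply: hb; exact: divr_gt0.
by split; [apply: (aux fst)|apply: (aux snd)] => s t Ds Dt hs ht; have [] := H s t Ds Dt hs ht.
Unshelve. all: by end_near. Qed.

Lemma curve_det_continuous x p : D x -> (fun h => det2 p (w (x + h))) @ 0 --> det2 p (w x).
Proof.
move=> Dx; have [c1 c2] := curve_continuous Dx.
by apply: cvgB; apply: cvgM => //; exact: cvg_cst.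
Qed.

(** The ratio is squeezed between 1 and a quotient of determinants tending to 1 by continuity. The
    upper bound uses a curve point on the other side of [x]: [E] for [h > 0], [F] for [h < 0]. *)
Lemma curve_det_equiv x : D x ->
  (fun h => det2 (w x) (w (x + h)) / h) @ 0^'+ --> (1 : R) /\
  (fun h => det2 (w x) (w (x + h)) / h) @ 0^'- --> (1 : R).
Proof.
move=> Dx; have [e e0 He] := Dopen Dx.
pose E := x - e / 2; pose F := x + e / 2.
have DE : D E by apply: He; rewrite /E addrAC subrr sub0r normrN gtr0_norm; lra.
have DF : D F by apply: He; rewrite /F addrAC subrr add0r gtr0_norm; lra.
have Ex : E < x by rewrite /E; lra.
have xF : x < F by rewrite /F; lra.
have E0 := curve_det_gt0 DE Dx Ex; have F0 := curve_det_gt0 Dx DF xF.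
have lim1 p : det2 p (w x) != 0 ->
    (fun h => det2 p (w (x + h)) / det2 p (w x)) @ 0 --> (1 : R).
  move=> p0; rewrite -(divff p0); apply: cvgM; [exact: curve_det_continuous|exact: cvg_cst].
split.
- apply: (@squeeze_cvgr _ _ _ _ (fun=> 1) (fun h => det2 (w E) (w (x + h)) / det2 (w E) (w x))).
  + near=> h.
    have h0 : 0 < h by near: h; exact: nbhs_right_gt.
    have he : h < e by near: h; exact: nbhs_right_lt.
    have Dh : D (x + h) by apply: He; rewrite addrAC subrr add0r gtr0_norm.
    have xh : x < x + h by rewrite ltrDl.
    have := det_ge Dx Dh xh; have := det_le_prev DE Dx Dh Ex xh.
    rewrite [x + h - x]addrAC subrr add0r => h1 h2.
    rewrite ler_pdivlMr// mul1r h2/= ler_pdivrMr// mulrAC ler_pdivlMr//.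
    by rewrite [_ * h]mulrC.
  + exact: cvg_cst.
  + by apply: cvg_at_right_filter; apply: lim1; rewrite gt_eqF.
- apply: (@squeeze_cvgr _ _ _ _ (fun=> 1) (fun h => det2 (w F) (w (x + h)) / det2 (w F) (w x))).
  + near=> h.
    have h0 : h < 0 by near: h; exact: nbhs_left_lt.
    have he : - e < h by near: h; apply: nbhs_left_gt; rewrite oppr_lt0.
    have Dh : D (x + h) by apply: He; rewrite addrAC subrr add0r ltr0_norm// ltrNl.
    have xh : x + h < x by rewrite gtrDl.
    have := det_ge Dh Dx xh; have := det_le_next Dh Dx DF xh xF.
    rewrite opprD addrA subrr sub0r => h1 h2.
    rewrite [det2 (w x) _]det2C [det2 (w F) (w (x + h))]det2C [det2 (w F) (w x)]det2C.
    rewrite invrN mulrNN mulNr -mulrN -invrN.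
    rewrite ler_pdivlMr ?oppr_gt0// mul1r h2/= ler_pdivrMr ?oppr_gt0// mulrAC ler_pdivlMr//.
    by rewrite [_ * - h]mulrC.
  + exact: cvg_cst.
  + by apply: cvg_at_left_filter; apply: lim1; rewrite det2C oppr_eq0 gt_eqF.
Unshelve. all: by end_near. Qed.

(** [Mp] and [Mm] are the limits of the monotone chord slopes at [x] from the right and the left. By
    monotonicity each also bounds the slopes on its own side, which gives the two one-sided support
    inequalities. *)
Lemma curve_one_sided x : D x -> exists (d : R * R) (Mm Mp : R),
  let a := w x in
  [/\ det2 a d = 1, Mm <= Mp,
    (forall t, D t -> x < t -> 1 <= det2 (w t) (slope_dir a d Mp)) /\
    (forall t, D t -> t < x -> 1 <= det2 (w t) (slope_dir a d Mm)),
    (forall m, (forall t, D t -> 1 <= det2 (w t) (slope_dir a d m)) -> Mm <= m <= Mp) &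
    [/\ right_deriv (fun t => (w t).1) x (slope_dir a d Mp).1,
        right_deriv (fun t => (w t).2) x (slope_dir a d Mp).2,
        left_deriv (fun t => (w t).1) x (slope_dir a d Mm).1 &
        left_deriv (fun t => (w t).2) x (slope_dir a d Mm).2]].
Proof.
move=> Dx; have [e e0 He] := Dopen Dx; set a := w x.
have a0 := sum_sqr_gt0 (Om_neq0 Hi (bdry_mem Hi (wb Dx))); rewrite -/a in a0.
pose n := a.1 ^+ 2 + a.2 ^+ 2.
(* The quarter turn of [a] divided by its squared length. *)
pose d : R * R := (- a.2 / n, a.1 / n).
have ad : det2 a d = 1.
  have n0 : a.1 ^+ 2 + a.2 ^+ 2 != 0 by rewrite gt_eqF.
  by rewrite /det2 /d /n /=; field.
have Dh h : `|h| < e -> D (x + h) by move=> hh; apply: He; rewrite addrAC subrr add0r.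
have hx h : h != 0 -> x + h != x by move=> h0; rewrite -subr_eq0 addrAC subrr add0r.
pose mm h := slope a d (w (x + h)).
have mono h k : `|h| < e -> `|k| < e -> h != 0 -> k != 0 -> h <= k -> mm h <= mm k.
  move=> he ke h0 k0; rewrite le_eqVlt => /orP[/eqP -> //|hk].
  by apply: curve_slope_le => //; [exact: Dh|exact: Dh|rewrite ltrD2l|exact: hx|exact: hx].
have e2 : `|e / 2| < e by rewrite gtr0_norm; lra.
have Ne2 : `|- (e / 2)| < e by rewrite normrN.
have e20 : 0 < e / 2 by lra.
have cp : cvg (mm h @[h --> 0^'+]).
  apply: nondecreasing_at_right_is_cvgr.
    near=> y; move=> h k; rewrite !in_itv/= => /andP[h0 hy] /andP[k0 ky] hk.
    have ye : y < e by near: y; exact: nbhs_right_lt.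
    by apply: mono => //; rewrite ?gt_eqF// gtr0_norm//; [apply: (lt_trans hy)|apply: (lt_trans ky)].
  near=> y; exists (mm (- (e / 2))); move=> z [h /=]; rewrite in_itv/= => /andP[h0 hy] <-.
  have ye : y < e by near: y; exact: nbhs_right_lt.
  apply: mono => //; rewrite ?oppr_eq0 ?gt_eqF//; last by lra.
  by rewrite gtr0_norm//; exact: lt_trans ye.
have cm : cvg (mm h @[h --> 0^'-]).
  apply: nondecreasing_at_left_is_cvgr.
    near=> y; move=> h k; rewrite !in_itv/= => /andP[hy h0] /andP[ky k0] hk.
    have ye : - e < y by near: y; apply: nbhs_left_gt; lra.
    by apply: mono => //; rewrite ?lt_eqF// ltr0_norm// ltrNl; [apply: (lt_trans ye)|apply: (lt_trans ye)].
  near=> y; exists (mm (e / 2)); move=> z [h /=]; rewrite in_itv/= => /andP[hy h0] <-.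
  have ye : - e < y by near: y; apply: nbhs_left_gt; lra.
  apply: mono => //; [|by rewrite lt_eqF|by rewrite gt_eqF|by lra].
  by rewrite ltr0_norm// ltrNl; exact: lt_trans hy.
pose Mp : R := lim (mm h @[h --> 0^'+]).
pose Mm : R := lim (mm h @[h --> 0^'-]).
have nr (y : R) : 0 < y -> \forall h \near 0^'+, 0 < h < y.
  by move=> y0; near=> h; apply/andP; split; near: h; [exact: nbhs_right_gt|exact: nbhs_right_lt].
have nl (y : R) : y < 0 -> \forall h \near 0^'-, y < h < 0.
  by move=> y0; near=> h; apply/andP; split; near: h; [exact: nbhs_left_gt|exact: nbhs_left_lt].
have Mp_ge m : (forall h, 0 < h < e -> m <= mm h) -> m <= Mp.
  by move=> H; apply: limr_ge => //; apply: filterS (nr e e0) => h; exact: H.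
have Mm_le m : (forall h, - e < h < 0 -> mm h <= m) -> Mm <= m.
  by move=> H; apply: limr_le => //; apply: filterS (nl (- e) _) => [h|]; [exact: H|lra].
have Mp_le t : D t -> x < t -> Mp <= slope a d (w t).
  move=> Dt xt; apply: limr_le => //.
  have : 0 < Num.min e (t - x) by rewrite lt_min e0 subr_gt0.
  move=> /nr; apply: filterS => h /andP[h0]; rewrite lt_min ltrBrDl => /andP[he ht].
  apply: curve_slope_le => //; first by apply: Dh; rewrite gtr0_norm.
    by apply: hx; rewrite gt_eqF.
  by rewrite gt_eqF.
have Mm_ge t : D t -> t < x -> slope a d (w t) <= Mm.
  move=> Dt xt; apply: limr_ge => //.
  have : Num.max (- e) (t - x) < 0 by rewrite gt_max subr_lt0 xt oppr_lt0 e0.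
  move=> /nl; apply: filterS => h /andP[]; rewrite gt_max ltrBlDl => /andP[he ht] h0.
  apply: curve_slope_le => //; first by apply: Dh; rewrite ltr0_norm// ltrNl.
    by rewrite lt_eqF.
  by apply: hx; rewrite lt_eqF.
have posd t : D t -> x < t -> 0 < det2 a (w t) by move=> Dt; exact: curve_det_gt0.
have negd t : D t -> t < x -> det2 a (w t) < 0.
  by move=> Dt tx; rewrite det2C oppr_lt0; exact: curve_det_gt0.
(* The chord is [det2 a (w (x + h))] times a [slope_dir]; after division by [h] the first factor
   tends to 1 and the slope to [M]. *)
have deriv (F : set_system R) (FF : Filter F) (M : R) :
    (\forall h \near F, `|h| < e /\ h != 0) ->
    mm h @[h --> F] --> M -> (fun h => det2 a (w (x + h)) / h) @ F --> (1 : R) ->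
    (fun h => h^-1 * ((w (x + h)).1 - a.1)) @ F --> M * a.1 + d.1 /\
    (fun h => h^-1 * ((w (x + h)).2 - a.2)) @ F --> M * a.2 + d.2.
  move=> Fe FM F1.
  have lim1 (c b : R) : (fun h => det2 a (w (x + h)) / h * (mm h * c + b)) @ F --> M * c + b.
    rewrite -[M * c + b]mul1r; apply: cvgM => //; apply: cvgD; last exact: cvg_cst.
    by apply: cvgM => //; exact: cvg_cst.
  have nz h : `|h| < e /\ h != 0 -> det2 a (w (x + h)) != 0.
    move=> [he h0]; have [hp|hn|hE] := ltgtP h 0.
    - by rewrite lt_eqF// negd ?gtrDl//; exact: Dh.
    - by rewrite gt_eqF// posd ?ltrDl//; exact: Dh.
    - by rewrite hE eqxx in h0.
  split; [apply: cvg_trans (lim1 a.1 d.1)|apply: cvg_trans (lim1 a.2 d.2)];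
    apply: near_eq_cvg; apply: filterS Fe => h hh; have [E1 E2] := slope_decomp ad (nz _ hh).
    by rewrite E1 -/(mm h) mulrA [_^-1 * _]mulrC.
  by rewrite E2 -/(mm h) mulrA [_^-1 * _]mulrC.
have [r1 r2] := curve_det_equiv Dx.
have [p1 p2] : (fun h => h^-1 * ((w (x + h)).1 - a.1)) @ 0^'+ --> Mp * a.1 + d.1 /\
    (fun h => h^-1 * ((w (x + h)).2 - a.2)) @ 0^'+ --> Mp * a.2 + d.2.
  apply: deriv => //; apply: filterS (nr e e0) => h /andP[h0 he].
  by rewrite gtr0_norm// gt_eqF.
have [q1 q2] : (fun h => h^-1 * ((w (x + h)).1 - a.1)) @ 0^'- --> Mm * a.1 + d.1 /\
    (fun h => h^-1 * ((w (x + h)).2 - a.2)) @ 0^'- --> Mm * a.2 + d.2.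
  apply: deriv => //; apply: filterS (nl (- e) _) => [h /andP[he h0]|]; last by lra.
  by rewrite ltr0_norm// lt_eqF// ltrNl.
exists d, Mm, Mp; split=> //.
- apply: Mp_ge => h /andP[h0 he]; apply: Mm_le => k /andP[ke k0].
  apply: mono; [by rewrite ltr0_norm// ltrNl|by rewrite gtr0_norm|by rewrite lt_eqF|by rewrite gt_eqF|].
  exact/ltW/(lt_trans k0).
- split=> t Dt xt; rewrite det2_slope_dir.
    have : Mp * det2 a (w t) <= slope a d (w t) * det2 a (w t).
      by rewrite ler_pM2r; [exact: Mp_le|exact: posd].
    by rewrite slopeK ?gt_eqF ?posd//; lra.
  have : Mm * det2 a (w t) <= slope a d (w t) * det2 a (w t).
    by rewrite ler_nM2r; [exact: Mm_ge|exact: negd].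
  by rewrite slopeK ?lt_eqF ?negd//; lra.
(* A supporting slope is at most every slope on the right and at least every slope on the left,
   hence lies between the limits. *)
- move=> m Hm; apply/andP; split.
    apply: Mm_le => h /andP[he h0].
    have Dt : D (x + h) by apply: Dh; rewrite ltr0_norm// ltrNl.
    have tx : x + h < x by rewrite gtrDl.
    rewrite -(ler_nM2r (negd _ Dt tx)) slopeK ?lt_eqF ?negd//.
    by have := Hm _ Dt; rewrite det2_slope_dir; lra.
  apply: Mp_ge => h /andP[h0 he].
  have Dt : D (x + h) by apply: Dh; rewrite gtr0_norm.
  have tx : x < x + h by rewrite ltrDl.
  rewrite -(ler_pM2r (posd _ Dt tx)) slopeK ?gt_eqF ?posd//.
  by have := Hm _ Dt; rewrite det2_slope_dir; lra.
Unshelve. all: by end_near. Qed.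

Hypothesis wsurj : forall p, bdry Om p -> exists2 t, D t & w t = p.

(** [det2 v d] is the pairing of [v] with [(d.2, d.1)], so the latter is a point of the antipolar
    dual to [w x]. *)
Definition support_dir x (d : R * R) : Prop :=
  det2 (w x) d = 1 /\ forall v, Om v -> 1 <= det2 v d.

Definition left_dir x (d : R * R) : Prop :=
  left_deriv (fun t => (w t).1) x d.1 /\ left_deriv (fun t => (w t).2) x d.2.

Definition right_dir x (d : R * R) : Prop :=
  right_deriv (fun t => (w t).1) x d.1 /\ right_deriv (fun t => (w t).2) x d.2.

Lemma det2_slope_dir_base x (d : R * R) (m : R) : det2 (w x) d = 1 ->
  det2 (w x) (slope_dir (w x) d m) = 1.
Proof. by move=> xd; rewrite det2_slope_dir xd (_ : det2 (w x) (w x) = 0) ?mulr0 ?subr0// /det2; ring. Qed.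

(** Each point of [Om] is a curve point scaled up, and scaling up can only increase a positive
    determinant, so testing on the curve suffices. *)
Lemma curve_support x (d : R * R) (m : R) : D x -> det2 (w x) d = 1 ->
  (forall t, D t -> t != x -> 1 <= det2 (w t) (slope_dir (w x) d m)) ->
  support_dir x (slope_dir (w x) d m).
Proof.
move=> Dx xd H; split; first exact: det2_slope_dir_base.
move=> v Ov; have [l [l0 l1 /wsurj[t Dt wt]]] := radial_bdry Hi Ov.
have : 1 <= l * det2 v (slope_dir (w x) d m).
  rewrite -det2Zl -wt; have [->|tx] := eqVneq t x; last exact: H.
  by rewrite det2_slope_dir_base.
move=> h; have y0 : 0 < det2 v (slope_dir (w x) d m).
  by rewrite -(pmulr_rgt0 _ l0); apply: lt_le_trans h.
by apply: (le_trans h); rewrite ger_pMl.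
Qed.

Lemma curve_dirs x : D x -> exists L Rr : R * R,
  [/\ support_dir x L, support_dir x Rr, left_dir x L, right_dir x Rr &
    forall d, support_dir x d -> between L.1 Rr.1 d.1 /\ between L.2 Rr.2 d.2].
Proof.
move=> Dx; have [d [Mm [Mp [xd MM [Hp Hm] Hb [p1 p2 q1 q2]]]]] := curve_one_sided Dx.
exists (slope_dir (w x) d Mm), (slope_dir (w x) d Mp).
split; [| |by split|by split|].
(* Each limit slope has its inequality on one side of [x]; on the other side it follows from
   [Mm <= Mp] and the sign of the determinant. *)
- apply: curve_support => // t Dt tx; have [lt|gt|E] := ltgtP t x; first exact: Hm.
    apply: (le_trans (Hp t Dt gt)); rewrite !det2_slope_dir lerD2l lerN2.
    by rewrite ler_pM2r//; exact: curve_det_gt0.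
  by rewrite E eqxx in tx.
- apply: curve_support => // t Dt tx; have [lt|gt|E] := ltgtP t x; last 1 first.
  + by rewrite E eqxx in tx.
  + apply: (le_trans (Hm t Dt lt)); rewrite !det2_slope_dir lerD2l lerN2.
    by rewrite ler_nM2r// det2C oppr_lt0; exact: curve_det_gt0.
  + exact: Hp.
move=> e [xe He].
(* Both [d] and [e] have determinant 1 against [w x], so they differ by a multiple of [w x], with
   factor [det2 e d]. *)
have eE : e = slope_dir (w x) d (det2 e d).
  have e1 : det2 (w x) d * e.1 = det2 e d * (w x).1 + det2 (w x) e * d.1.
    by rewrite /det2; ring.
  have e2 : det2 (w x) d * e.2 = det2 e d * (w x).2 + det2 (w x) e * d.2.
    by rewrite /det2; ring.
  by rewrite xd xe !mul1r in e1 e2; rewrite /slope_dir -e1 -e2 -surjective_pairing.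
have mM : Mm <= det2 e d <= Mp.
  by apply: Hb => t Dt; rewrite -eE; apply: He; exact: (bdry_mem Hi (wb Dt)).
by rewrite eE; split; exact: between_affine.
Qed.

(* At a corner, a rational direction strictly between the one-sided ones defines
   a functional whose minimum over the curve is attained at the corner only. *)
Lemma curve_corner x : D x -> ~ (exists d, left_dir x d /\ right_dir x d) ->
  exists q : rat * rat, forall t, D t -> t != x ->
    det2 (w x) (ratr q.1, ratr q.2) < det2 (w t) (ratr q.1, ratr q.2).
Proof.
move=> Dx nd; have [d [Mm [Mp [xd MM [Hp Hm] _ [p1 p2 q1 q2]]]]] := curve_one_sided Dx.
have {MM} MM : Mm < Mp.
  rewrite lt_neqAle MM andbT; apply/eqP => E; apply: nd.
  by exists (slope_dir (w x) d Mp); split; split=> //; rewrite -E.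
set a := w x in xd Hp Hm *.
pose m := (Mm + Mp) / 2; pose e := slope_dir a d m.
have e1 : det2 a e = 1 by exact: det2_slope_dir_base.
have ed : det2 e d = m.
  have -> : det2 e d = m * det2 a d by rewrite /e /det2/=; ring.
  by rewrite xd mulr1.
have op (c b : R) : 0 < c * e.1 + b * e.2 -> \forall p \near e, 0 < c * p.1 + b * p.2.
  by move=> h; apply: (cvgr_gt _ (@continuous_pairing R c b e)).
(* Three open conditions that hold at [e]: [p] has positive determinant against [a], and its slope
   [det2 p d / det2 a p] is strictly between [Mm] and [Mp]. *)
have n1 : \forall p \near e, 0 < det2 a p.
  have : \forall p \near e, 0 < (- a.2) * p.1 + a.1 * p.2.
    by apply: op; move: e1; rewrite /det2; lra.
  by apply: filterS => p; rewrite /det2; lra.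
have n2 : \forall p \near e, 0 < det2 p d - Mm * det2 a p.
  have E p : (d.2 + Mm * a.2) * p.1 + (- d.1 - Mm * a.1) * p.2 = det2 p d - Mm * det2 a p.
    by rewrite /det2; ring.
  have : \forall p \near e, 0 < (d.2 + Mm * a.2) * p.1 + (- d.1 - Mm * a.1) * p.2.
    by apply: op; rewrite E ed e1 /m; lra.
  by apply: filterS => p; rewrite E.
have n3 : \forall p \near e, 0 < Mp * det2 a p - det2 p d.
  have E p : (- d.2 - Mp * a.2) * p.1 + (d.1 + Mp * a.1) * p.2 = Mp * det2 a p - det2 p d.
    by rewrite /det2; ring.
  have : \forall p \near e, 0 < (- d.2 - Mp * a.2) * p.1 + (d.1 + Mp * a.1) * p.2.
    by apply: op; rewrite E ed e1 /m; lra.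
  by apply: filterS => p; rewrite E.
have [q] := rat_plane_dense (filterI n1 (filterI n2 n3)).
set p := (_, _) => -[be [g1 g2]]; exists q => t Dt tx; rewrite -/p.
have J : det2 (w t) p = det2 a p * det2 (w t) d - det2 p d * det2 a (w t).
  by rewrite -[LHS]mul1r -xd /det2; ring.
(* With [M] the limit slope of the side of [t], the term [s * det2 a (w t)] is negative, which makes
   the inequality strict. *)
have key M s : 1 <= det2 (w t) (slope_dir a d M) -> s = det2 p d - M * det2 a p ->
    s * det2 a (w t) < 0 -> det2 a p < det2 (w t) p.
  move=> h -> hs; rewrite J; move: h; rewrite det2_slope_dir => h.
  have : det2 a p * 1 <= det2 a p * (det2 (w t) d - M * det2 a (w t)) by rewrite ler_pM2l.
  by move: hs; lra.
have [lt|gt|E] := ltgtP t x.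
- apply: (key Mm _ (Hm t Dt lt) erefl); rewrite pmulr_rlt0// det2C oppr_lt0.
  exact: curve_det_gt0.
- apply: (key Mp _ (Hp t Dt gt) erefl); rewrite nmulr_rlt0; last by lra.
  exact: curve_det_gt0.
- by rewrite E eqxx in tx.
Qed.

(** Two corners sharing a rational pair would each be the strict minimiser of the same functional,
    so the choice of pairs is injective on corners. *)
Lemma curve_corners_countable :
  countable [set x | D x /\ ~ (exists d, left_dir x d /\ right_dir x d)].
Proof.
have /choice[f fP] x : exists q : rat * rat,
    D x /\ ~ (exists d, left_dir x d /\ right_dir x d) ->
    forall t, D t -> t != x ->
    det2 (w x) (ratr q.1, ratr q.2) < det2 (w t) (ratr q.1, ratr q.2).
  have [[Dx nd]|h] := pselect (D x /\ ~ (exists d, left_dir x d /\ right_dir x d)).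
    by have [q qP] := curve_corner Dx nd; exists q.
  by exists (0, 0).
apply/countable_injP; exists (fun x => pickle (f x)) => x y /set_mem Jx /set_mem Jy /(pcan_inj pickleK) fxy.
apply: contrapT => /eqP xy.
have yx : y != x by rewrite eq_sym.
have := fP x Jx y Jy.1 yx; rewrite fxy => /lt_trans/(_ (fP y Jy x Jx.1 xy)).
by rewrite ltxx.
Qed.

End Curve.

(** * The hyperbolic functions as a parametrised boundary *)

Section HyperbolicTrig.
Context {R : realType}.
Variables (Om : set (R * R)) (w0 : R * R) (ch sh : R -> R).
Hypotheses (Hi : prop_i Om) (Hs : prop_star Om) (bw0 : bdry Om w0).
Hypothesis trig : is_hyp_trig Om w0 ch sh.
Let D := angle_dom Om w0.
Let w (t : R) : R * R := (ch t, sh t).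
Let HA := fun a b ba bb ab => @angle_diff_bounds R Om w0 Hi Hs bw0 a b ba bb ab.

Lemma hyp_trig_bdry t : D t -> bdry Om (w t).
Proof. by move=> /trig[]. Qed.

Lemma hyp_trig_angle t : D t -> angle Om w0 (w t) = t.
Proof. by move=> /trig[]. Qed.

Lemma hyp_trig_dom_open x : D x ->
  exists2 e : R, 0 < e & forall t, `|t - x| < e -> D t.
Proof.
move=> [a ba <-]; have [e e0 H] := param_open Hi Hs HA ba.
by exists e => // t /H[p bp <-]; exists p.
Qed.

(** The angle is injective on the boundary, so [w] inverts it. *)
Lemma hyp_trig_surj p : bdry Om p -> D (angle Om w0 p) /\ w (angle Om w0 p) = p.
Proof.
move=> bp; have Dp : D (angle Om w0 p) by exists p.
by split; [|exact: (param_inj Hi Hs HA (hyp_trig_bdry Dp) bp (hyp_trig_angle Dp))].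
Qed.

Lemma hyp_trig_det_gt0 s t : D s -> D t -> s < t -> 0 < det2 (w s) (w t).
Proof.
move=> Ds Dt st.
apply: (det2_of_param_lt Hi Hs HA); try exact: hyp_trig_bdry.
by rewrite !hyp_trig_angle.
Qed.

Lemma hyp_trig_area s t : D s -> D t -> s < t ->
  2 * area (sector Om (w s) (w t)) = t - s.
Proof.
move=> Ds Dt st; rewrite -[in RHS](hyp_trig_angle Ds) -[in RHS](hyp_trig_angle Dt).
apply/esym/angle_diff => //; try exact: hyp_trig_bdry.
exact: hyp_trig_det_gt0.
Qed.

Lemma hyp_trig_det_ge s t : D s -> D t -> s < t -> t - s <= det2 (w s) (w t).
Proof.
move=> Ds Dt st; rewrite -hyp_trig_area//.
by have [_ /andP[]] := sector_measure Hi Hs (hyp_trig_bdry Ds) (hyp_trig_bdry Dt)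
  (hyp_trig_det_gt0 Ds Dt st).
Qed.

Lemma hyp_trig_det_le_prev e s t : D e -> D s -> D t -> e < s -> s < t ->
  det2 (w s) (w t) * det2 (w e) (w s) <= (t - s) * det2 (w e) (w t).
Proof.
move=> De Ds Dt es st; rewrite -hyp_trig_area//.
apply: (sector_area_ge_prev Hi Hs (bdry_mem Hi (hyp_trig_bdry De)) (hyp_trig_bdry Ds)
  (hyp_trig_bdry Dt)); exact: hyp_trig_det_gt0.
Qed.

Lemma hyp_trig_det_le_next s t f : D s -> D t -> D f -> s < t -> t < f ->
  det2 (w s) (w t) * det2 (w t) (w f) <= (t - s) * det2 (w s) (w f).
Proof.
move=> Ds Dt Df st tf; rewrite -hyp_trig_area//.
apply: (sector_area_ge_next Hi Hs (bdry_mem Hi (hyp_trig_bdry Df)) (hyp_trig_bdry Ds)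
  (hyp_trig_bdry Dt)); exact: hyp_trig_det_gt0.
Qed.
End HyperbolicTrig.

(** * Dual angles as support directions, and the derivatives of the hyperbolic functions *)

Lemma closure_nonempty (T : topologicalType) (A : set T) x : closure A x -> A !=set0.
Proof. by move=> /(_ setT filterT)[y [Ay _]]; exists y. Qed.

(** A support direction with exchanged coordinates is a boundary point of the antipolar, and its
    angle is the required [eta]. Recovering the point from its angle relies on [prop_star] for the
    antipolar. *)
Lemma dual_angles_support (R : realType) (Om : set (R * R)) (w0d : R * R)
    (ch sh chd shd : R -> R) :
  prop_i Om -> prop_2star Om -> bdry (antipolar Om) w0d ->
  is_hyp_trig (antipolar Om) w0d chd shd ->
  forall x, Om (ch x, sh x) -> forall d : R * R,
  support_dir Om (fun t => (ch t, sh t)) x d <->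
  exists2 eta, dual_angles (antipolar Om) w0d ch sh chd shd x eta & d = (shd eta, chd eta).
Proof.
move=> Hi H2 bw0d trd x Ox d.
have Hid : prop_i (antipolar Om) by apply: antipolar_prop_i => //; exact: closure_nonempty bw0d.1.
have Hsd := antipolar_prop_star Hi H2.
split.
  move=> [xd Hd]; pose p : R * R := (d.2, d.1).
  have Ap : antipolar Om p by move=> v Ov; have := Hd v Ov; rewrite /det2/= mulrC [_ * d.1]mulrC.
  have bp : bdry (antipolar Om) p.
    by apply: (antipolar_bdry Ap Ox); rewrite /= -xd /det2 /= mulrC [_ * d.1]mulrC.
  have [De E] := hyp_trig_surj Hid Hsd bw0d trd bp.
  exists (angle (antipolar Om) w0d p); last first.
    by move: E => -[-> ->]; rewrite /p /= -surjective_pairing.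
  by split=> //; move: E => -[-> ->]; rewrite -xd.
move=> [eta [De E] ->]; split; first by rewrite /det2.
move=> v Ov; have /(_ v Ov) := bdry_mem Hid (hyp_trig_bdry trd De).
by rewrite /det2 /= mulrC [_ * v.2]mulrC.
Qed.

Theorem theorem5 (R : realType) (Om : set (R * R)) (w0 w0d : R * R)
    (ch sh chd shd : R -> R) :
  prop_i Om -> prop_star Om -> prop_2star Om ->
  bdry Om w0 -> bdry (antipolar Om) w0d -> w0d.1 * w0.1 - w0d.2 * w0.2 = 1 ->
  is_hyp_trig Om w0 ch sh ->
  is_hyp_trig (antipolar Om) w0d chd shd ->
  let D := angle_dom Om w0 in
  let Td := dual_angles (antipolar Om) w0d ch sh chd shd in
  (* locally Lipschitz, hence differentiable almost everywhere *)
  (locally_lipschitz_on D ch /\ locally_lipschitz_on D sh /\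
   {ae lebesgue_measure, forall t, D t -> derivable ch t 1 /\ derivable sh t 1}) /\
  (* derivative formulas when theta^diamond is a singleton *)
  (forall theta eta, D theta -> Td theta = [set eta] ->
     is_derive theta 1 ch (shd eta) /\ is_derive theta 1 sh (chd eta)) /\
  (* one-sided derivatives: countably many jumps, and the dual values lie between *)
  (forall theta, D theta ->
     (exists l, left_deriv ch theta l) /\ (exists r, right_deriv ch theta r) /\
     (exists l, left_deriv sh theta l) /\ (exists r, right_deriv sh theta r)) /\
  countable [set theta | D theta /\ exists l r,
     left_deriv ch theta l /\ right_deriv ch theta r /\ l != r] /\
  countable [set theta | D theta /\ exists l r,
     left_deriv sh theta l /\ right_deriv sh theta r /\ l != r] /\
  (forall theta l r, D theta -> left_deriv ch theta l -> right_deriv ch theta r ->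
     l != r -> forall eta, Td theta eta -> between l r (shd eta)) /\
  (forall theta l r, D theta -> left_deriv sh theta l -> right_deriv sh theta r ->
     l != r -> forall eta, Td theta eta -> between l r (chd eta)).
Proof.
move=> Hi Hs H2 bw0 bw0d _ tr trd D Td.
have wb := hyp_trig_bdry tr.
have Dopen := hyp_trig_dom_open Hi Hs bw0.
have dg := hyp_trig_det_ge Hi Hs bw0 tr.
have dp := hyp_trig_det_le_prev Hi Hs bw0 tr.
have dn := hyp_trig_det_le_next Hi Hs bw0 tr.
have ws p : bdry Om p -> exists2 t, D t & (ch t, sh t) = p.
  by move=> /(hyp_trig_surj Hi Hs bw0 tr)[Dp E]; exists (angle Om w0 p).
have sup x : D x -> forall d, support_dir Om (fun t => (ch t, sh t)) x d <->
    exists2 eta, Td x eta & d = (shd eta, chd eta).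
  move=> Dx; apply: (@dual_angles_support R Om w0d ch sh chd shd Hi H2 bw0d trd).
  exact: (bdry_mem Hi (wb x Dx)).
rewrite -/D in Dopen wb dg dp dn; clearbody D Td.
clear tr trd bw0 bw0d H2 w0 w0d.
have dirs := curve_dirs Hi Hs Dopen wb dg dp dn ws.
have ctb := curve_corners_countable Hi Hs Dopen wb dg dp dn.
have lip := curve_lipschitz Hi Hs Dopen wb dg dp.
set J := [set x | _] in ctb.
have drv x : D x -> ~ J x -> exists d : R * R, is_derive x 1 ch d.1 /\ is_derive x 1 sh d.2.
  move=> Dx nJ; have [d [[l1 l2] [r1 r2]]] : exists d, left_dir (fun t => (ch t, sh t)) x d /\
      right_dir (fun t => (ch t, sh t)) x d.
    by apply: contrapT => h; apply: nJ.
  by exists d; split; exact: is_derive_one_sided.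
split; [split; [|split]|split; [|split; [|split; [|split; [|split]]]]].
- move=> x Dx; have [e [k [e0 H]]] := lip x Dx; exists e, k; split=> // a b Da Db ha hb.
  by have [] := H a b Da Db ha hb.
- move=> x Dx; have [e [k [e0 H]]] := lip x Dx; exists e, k; split=> // a b Da Db ha hb.
  by have [] := H a b Da Db ha hb.
(* The corners form a countable, hence null, set outside which both functions are differentiable. *)
- exists J; split; [exact: countable_measurable|exact: countable_lebesgue_measure0|].
  move=> x /= h; apply: contrapT => nJ; apply: h => Dx.
  by have [d [[? _] [? _]]] := drv x Dx nJ.
(* The left and right directions are both support directions, so a single dual angle forces them to
   coincide. *)
- move=> x eta Dx Teta; have [L [Rr [sL sR [l1 l2] [r1 r2] _]]] := dirs x Dx.
  have one d : support_dir Om (fun t => (ch t, sh t)) x d -> d = (shd eta, chd eta).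
    by move=> /(sup x Dx)[eta']; rewrite Teta => ->.
  rewrite (one _ sL) /= in l1 l2; rewrite (one _ sR) /= in r1 r2.
  by split; exact: is_derive_one_sided.
- move=> x Dx; have [L [Rr [_ _ [l1 l2] [r1 r2] _]]] := dirs x Dx.
  by split; [exists L.1|split; [exists Rr.1|split; [exists L.2|exists Rr.2]]].
(* Different one-sided derivatives of a coordinate exclude a common direction, so the point is a
   corner. *)
- apply: sub_countable ctb; apply: subset_card_le => x [Dx [l [r [hl [hr lr]]]]].
  split=> // -[d [[l1 _] [r1 _]]]; move/eqP: lr; apply.
  by rewrite (left_deriv_unique hl l1) (right_deriv_unique hr r1).
- apply: sub_countable ctb; apply: subset_card_le => x [Dx [l [r [hl [hr lr]]]]].
  split=> // -[d [[_ l2] [_ r2]]]; move/eqP: lr; apply.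
  by rewrite (left_deriv_unique hl l2) (right_deriv_unique hr r2).
- move=> x l r Dx hl hr _ eta Te; have [L [Rr [_ _ [l1 l2] [r1 r2] H]]] := dirs x Dx.
  rewrite (left_deriv_unique hl l1) (right_deriv_unique hr r1).
  have /H[] // : support_dir Om (fun t => (ch t, sh t)) x (shd eta, chd eta).
  by apply/(sup x Dx); exists eta.
- move=> x l r Dx hl hr _ eta Te; have [L [Rr [_ _ [l1 l2] [r1 r2] H]]] := dirs x Dx.
  rewrite (left_deriv_unique hl l2) (right_deriv_unique hr r2).
  have /H[] // : support_dir Om (fun t => (ch t, sh t)) x (shd eta, chd eta).
  by apply/(sup x Dx); exists eta.
Qed.
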